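(* Let $\mathcal{B}=\{n\in\mathbb{N}: f(n)\mid n\}$ and $\mathcal{B}(x)=\{n\in\mathcal{B}: n\le x\}$. Then $$\#\mathcal{B}(x)=\frac{x}{(\log x)^{1+o(1)}}\qquad\text{as } x\to\infty.$$ That is, for every $\varepsilon>0$ there is $x_0(\varepsilon)$ such that for all real $x\ge x_0(\varepsilon)$, $$\frac{x}{(\log x)^{1+\varepsilon}}\le \#\mathcal{B}(x)\le \frac{x}{(\log x)^{1-\varepsilon}}.$$
   Context: For a positive integer $n$, $f(n)$ denotes the number of distinct unordered factorisations of $n$ into integer factors larger than $1$, i.e. the number of finite multisets of integers $>1$ whose product is $n$ (the one-factor factorisation $n$ itself is counted when $n>1$). For example $f(28)=4$, from $28,\ 2\cdot 14,\ 4\cdot 7,\ 2\cdot 2\cdot 7$. Here $\mathbb{N}$ is the set of positive integers and $\log$ is the natural logarithm. *)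

(* Defs.v *)
From HB Require Import structures.
From mathcomp Require Import all_boot all_order all_algebra.
From mathcomp Require Import finmap multiset.
From mathcomp Require Import all_classical all_reals all_analysis.

Set Implicit Arguments.
Unset Strict Implicit.
Unset Printing Implicit Defensive.

Import Order.TTheory GRing.Theory Num.Theory.

Local Open Scope classical_set_scope.
Local Open Scope mset_scope.
Local Open Scope nat_scope.

(* The empty multiset is the unique factorisation of 1. *)
Definition factorisations (n : nat) : set {mset nat} :=
  [set A : {mset nat} | (forall d, d \in A -> 1 < d) /\ \prod_(d <- A) d = n].

(* [fset_set] returns the empty set on infinite arguments, hence the two
   finiteness lemmas below. *)
Definition f (n : nat) : nat := #|` fset_set (factorisations n)|.

Definition B : set nat := [set n | 0 < n /\ f n %| n].

Definition Bupto (R : realType) (x : R) : set nat :=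
  [set n | B n /\ (n%:R <= x)%R].

Definition countB (R : realType) (x : R) : nat := #|` fset_set (Bupto x)|.

Lemma prod_gt1_bound (s : seq nat) :
  all (fun d => 1 < d) s ->
  size s < \prod_(d <- s) d /\ forall d, d \in s -> d <= \prod_(d <- s) d.
Proof.
elim: s => [|a s IHs] /=; first by rewrite big_nil.
case/andP=> a_gt1 /IHs [sz_lt le_prod]; rewrite big_cons.
have p_gt0 : 0 < \prod_(d <- s) d by apply: leq_ltn_trans sz_lt.
have a_gt0 : 0 < a by apply: ltnW.
split.
  by apply: leq_ltn_trans sz_lt _; apply: ltn_Pmull.
move=> d; rewrite inE => /orP[/eqP ->|ds]; first by rewrite leq_pmulr.
by apply: leq_trans (le_prod _ ds) _; rewrite leq_pmull.
Qed.

Lemma finite_factorisations (n : nat) : finite_set (factorisations n).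
Proof.
pose g (t : {k : 'I_n.+1 & k.-tuple 'I_n.+1}) : {mset nat} :=
  seq_mset [seq val i | i <- tagged t].
apply: (@sub_finite_set _ _ (range g)); last first.
  by apply: finite_image; apply: finite_finset.
move=> A [A_gt1 prodA].
have [] := @prod_gt1_bound A; first by apply/allP => d; apply: A_gt1.
rewrite prodA => szA leA.
have szA' : size A < n.+1 by apply: ltnW.
have szP : size [seq inord d : 'I_n.+1 | d <- A] == Ordinal szA'.
  by rewrite size_map.
exists (Tagged (fun k : 'I_n.+1 => k.-tuple 'I_n.+1) (Tuple szP)) => //.
rewrite /g /= -map_comp (_ : map _ _ = A :> seq nat).
  exact: seq_mset_id.
rewrite -[RHS]map_id; apply/eq_in_map => d dA /=.
by rewrite inordK // ltnS leA.
Qed.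

Lemma finite_Bupto (R : realType) (x : R) : finite_set (Bupto x).
Proof.
apply: (@sub_finite_set _ _ `I_(Num.truncn x).+1) => [n [_ le_nx]|] /=; last first.
  exact: finite_II.
have x_ge0 : (0 <= x)%R by apply: le_trans le_nx; apply: ler0n.
by rewrite ltnS truncn_ge_nat.
Qed.

(* Main.v *)
Require Import Defs.
From mathcomp Require Import all_boot all_order all_algebra.
From mathcomp Require Import finmap multiset.
From mathcomp Require Import all_classical all_reals all_analysis.
From mathcomp Require Import zify ring lra.

(* Lower bound: f p = 1 for every prime p, and Chebyshev's estimate follows from
   2 ^ n <= 'C(2n, n) <= (2n) ^ primepi (2n).

   Upper bound: put 2 ^ t <= ln x < 2 ^ (t + 1). Up to O(x / ln x) exceptions, n has
   no square divisor a ^ 2 with a >= 2 ^ t (the sum of x / a ^ 2 is small), and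
   fewer than 2t + 2 prime divisors (2 ^ omega n is at most the number of divisors
   of n). Then n has at most 4t + 1 prime factors with multiplicity. As f n depends
   only on the multiset of exponents of n, it takes at most
   p(1) + ... + p(4t + 1) = 2 ^ o(t) values on such n, and each value v >= 2 ^ t
   contributes at most x / v elements n with v | n.
   If f n < 2 ^ t, then f n >= m ^ (omega n - m) forces omega n <= m + t / log2 m,
   hence omega n <= delta t for m large. Such n are counted by Chebyshev's argument
   (write ln n as a sum over primes p | n): their number is at most a constant times
   x / ln x times the sum of 1 / m over m <= x with omega m <= delta t. This sum is
   (ln x) ^ o(1): for r = 2 ^ c the r-th power of the sum of r ^ - bigomega m / m
   over m <= x is at most the harmonic sum up to x ^ r, because n has at most
   r ^ bigomega n representations as an ordered product of r factors. *)

Import Order.TTheory GRing.Theory Num.Theory.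

Local Open Scope mset_scope.
Local Open Scope nat_scope.

(** * Arithmetic functions and Chebyshev's estimates *)

Definition omega n := size (primes n).
Definition bigomega n := \sum_(p <- primes n) logn p n.

(** A summation range independent of [n] lets [bigomegaM] add valuations prime by prime. *)
Lemma bigomega_widen M n : n < M -> bigomega n = \sum_(0 <= p < M) logn p n.
Proof.
move=> ltnM; case: (posnP n) => [->|n_gt0].
  by rewrite /bigomega big_nil big1 // => p _; rewrite logn0.
rewrite /bigomega [RHS](bigID (mem (primes n))) /= [X in _ + X]big1 ?addn0; last first.
  by move=> p; rewrite -logn_gt0 -eqn0Ngt => /eqP.
rewrite -[in RHS]big_filter; apply: perm_big; apply: uniq_perm.
- exact: primes_uniq.
- by rewrite filter_uniq ?iota_uniq.
move=> p; rewrite mem_filter mem_index_iota /=.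
case: (boolP (p \in primes n)) => //=; rewrite mem_primes => /and3P[_ _ /dvdn_leq].
by move=> /(_ n_gt0) le; rewrite (leq_ltn_trans le ltnM).
Qed.

Lemma bigomegaM m n : 0 < m -> 0 < n -> bigomega (m * n) = bigomega m + bigomega n.
Proof.
move=> m_gt0 n_gt0; have lt1: m * n < (m * n).+1 by [].
have lt2: m < (m * n).+1 by rewrite ltnS leq_pmulr.
have lt3: n < (m * n).+1 by rewrite ltnS leq_pmull.
rewrite (bigomega_widen _ _ lt1) (bigomega_widen _ _ lt2) (bigomega_widen _ _ lt3).
by rewrite -big_split; apply: eq_bigr => p _; rewrite lognM.
Qed.

Lemma bigomega_prime p : prime p -> bigomega p = 1.
Proof. by move=> pr; rewrite /bigomega primes_prime // big_seq1 logn_prime // eqxx. Qed.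

Lemma prod_primes n : 0 < n -> n = \prod_(p <- primes n) p ^ logn p n.
Proof. by move=> n_gt0; rewrite {1}[n]prod_prime_decomp // prime_decompE big_map. Qed.

Lemma exp2_bigomega n : 0 < n -> 2 ^ bigomega n <= n.
Proof.
move=> n_gt0; rewrite {2}[n]prod_primes // expn_sum big_seq_cond [leqRHS]big_seq_cond.
apply: leq_prod => p; rewrite andbT mem_primes => /and3P[/prime_gt1 p_gt1 _ _].
by case: (logn p n) => // k; rewrite leq_exp2r.
Qed.

Lemma nat_prime_ind (P : nat -> Prop) :
  P 1 -> (forall p n, prime p -> 0 < n -> P n -> P (p * n)) -> forall n, 0 < n -> P n.
Proof.
move=> P1 PM n; have [k] := ubnP n; elim: k n => // k IH n le n_gt0.
case: (ltngtP n 1) => [||->//]; first by case: n n_gt0 {le}.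
move=> n_gt1; have pr := pdiv_prime n_gt1; have dv := pdiv_dvd n.
have q_gt0 : 0 < n %/ pdiv n by rewrite divn_gt0 ?prime_gt0 // dvdn_leq.
rewrite -(divnK dv) mulnC; apply: PM => //; apply: IH => //.
by rewrite -ltnS; apply: leq_trans le; rewrite ltnS ltn_Pdiv ?prime_gt1.
Qed.

(** A divisor of [p * n] either divides [n] or is [p] times a divisor of [n], so each prime factor
    at most doubles the count. *)
Lemma size_divisors_le n : 0 < n -> size (divisors n) <= 2 ^ bigomega n.
Proof.
elim/nat_prime_ind: n / => [|p n pr n_gt0 IH]; first by rewrite /bigomega big_nil.
have p_gt0 := prime_gt0 pr.
rewrite bigomegaM // bigomega_prime // expnS mul2n -addnn.
have sub : {subset divisors (p * n) <= divisors n ++ [seq p * d | d <- divisors n]}.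
  move=> d; rewrite mem_cat -!dvdn_divisors ?muln_gt0 ?p_gt0 // => dv.
  case: (boolP (p %| d)) => [/dvdnP[e de]|npd].
    apply/orP; right; apply/mapP; exists e; last by rewrite mulnC.
    by move: dv; rewrite de mulnC dvdn_pmul2l // dvdn_divisors.
  by rewrite -(@Gauss_dvdr _ p) ?dv // coprime_sym prime_coprime.
apply: leq_trans (uniq_leq_size (divisors_uniq _) sub) _.
by rewrite size_cat size_map leq_add.
Qed.

(** A new prime [p] doubles the count: the divisors [d] of [n] and the products [p * d] are disjoint
    families of divisors of [p * n]. A repeated prime leaves [omega] unchanged. *)
Lemma exp2_omega_le n : 0 < n -> 2 ^ omega n <= size (divisors n).
Proof.
elim/nat_prime_ind: n / => [//|p n pr n_gt0 IH].
have p_gt0 := prime_gt0 pr.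
have subn : {subset divisors n <= divisors (p * n)}.
  by move=> d; rewrite -!dvdn_divisors ?muln_gt0 ?p_gt0 // => /dvdn_mull->.
case: (boolP (p %| n)) => dvp.
  apply: leq_trans (uniq_leq_size (divisors_uniq _) subn); apply: leq_trans IH.
  rewrite leq_exp2l // uniq_leq_size ?primes_uniq // => q.
  by rewrite primesM // primes_prime // !inE => /orP[/eqP->|//]; rewrite mem_primes pr n_gt0.
have -> : omega (p * n) = (omega n).+1.
  suff/perm_size : perm_eq (primes (p * n)) (p :: primes n) by [].
  apply: uniq_perm; rewrite ?primes_uniq //= ?primes_uniq ?andbT.
    by rewrite mem_primes pr n_gt0.
  by move=> q; rewrite primesM // primes_prime // !inE.
have: uniq (divisors n ++ [seq p * d | d <- divisors n]).
  rewrite cat_uniq divisors_uniq /= map_inj_uniq ?divisors_uniq ?andbT; last first.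
    by move=> x y /eqP; rewrite eqn_pmul2l // => /eqP.
  apply/hasPn => _ /mapP[d _ ->] /=; rewrite -dvdn_divisors //.
  by apply: contra dvp; apply: dvdn_trans; apply: dvdn_mulr.
move=> /uniq_leq_size sub; have {sub}: size (divisors n ++ [seq p * d | d <- divisors n]) <= size (divisors (p * n)).
  apply: sub => d; rewrite mem_cat => /orP[/subn//|/mapP[e]].
  by rewrite -!dvdn_divisors ?muln_gt0 ?p_gt0 // => dv ->; rewrite dvdn_pmul2l.
by apply: leq_trans; rewrite size_cat size_map expnS mul2n -addnn leq_add.
Qed.

Lemma square_decomposition n : 0 < n ->
  exists a s, n = a ^ 2 * s /\ forall p, logn p s <= 1.
Proof.
have [k] := ubnP n; elim: k n => // k IH n le n_gt0.
case: (boolP (has (fun p => 1 < logn p n) (primes n))) => [/hasP[p]|/hasPn sqf]; last first.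
  exists 1, n; split=> [|p]; first by rewrite exp1n mul1n.
  rewrite leqNgt; apply/negP => gt1; have := sqf p; rewrite -logn_gt0 gt1 => /(_ (ltnW gt1)).
  by [].
rewrite mem_primes => /and3P[pr _ _]; rewrite -pfactor_dvdn // => dv.
have p2 : 1 < p ^ 2 by rewrite -[1]/(1 ^ 2) ltn_exp2r ?prime_gt1.
have q_gt0 : 0 < n %/ p ^ 2 by rewrite divn_gt0 ?expn_gt0 ?prime_gt0 // dvdn_leq.
have [|//|a [s [ns sq]]] := IH (n %/ p ^ 2).
  by rewrite -ltnS; apply: leq_trans le; rewrite ltnS ltn_Pdiv.
by exists (p * a), s; split=> //; rewrite expnMn -mulnA -ns mulnC divnK.
Qed.

Lemma bigomega_sqf s : (forall p, logn p s <= 1) -> bigomega s = omega s.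
Proof.
move=> sq; rewrite /bigomega /omega -sum1_size; apply: eq_big_seq => p.
by rewrite -logn_gt0; have := sq p; case: logn => [|[]].
Qed.

Lemma prod_primes_sqf s : 0 < s -> (forall p, logn p s <= 1) -> \prod_(p <- primes s) p = s.
Proof.
move=> s_gt0 sq; rewrite [RHS]prod_primes //; apply: eq_big_seq => p.
by rewrite -logn_gt0; have := sq p; case: logn => [|[]].
Qed.

Lemma omega_dvdn m n : 0 < n -> m %| n -> omega m <= omega n.
Proof.
move=> n_gt0 dv; apply: uniq_leq_size; first exact: primes_uniq.
move=> p; rewrite !mem_primes n_gt0 => /and3P[-> _ /= pm]; exact: dvdn_trans dv.
Qed.

Definition primorial n := \prod_(0 <= p < n.+1 | prime p) p.

Lemma prod_primes_dvdn m s :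
  uniq s -> all (fun p => prime p && (p %| m)) s -> \prod_(p <- s) p %| m.
Proof.
elim: s => [|p s IH] /=; first by rewrite big_nil dvd1n.
move=> /andP[ps us] /andP[/andP[pr dv] al]; rewrite big_cons Gauss_dvd ?dv ?IH //.
rewrite prime_coprime // Euclid_dvd_prod // big_has.
apply/hasPn => q sq; have /allP/(_ q sq)/andP[prq _] := al.
by rewrite dvdn_prime2 //; apply: contraNneq ps => ->.
Qed.

(** A prime in the interval from [a + 1] to [a + b] divides [(a + b)!] but neither [a!] nor, as
    [b <= a], [b!]; hence it divides the binomial coefficient. *)
Lemma primorial_bin a b : b <= a -> primorial (a + b) <= primorial a * 'C(a + b, b).
Proof.
move=> leba; rewrite /primorial (@big_cat_nat _ _ _ a.+1) //= ?ltnS ?leq_addr //.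
rewrite leq_mul2l; apply/orP; right.
apply: dvdn_leq; first by rewrite bin_gt0 leq_addl.
rewrite -big_filter; apply: prod_primes_dvdn; first by rewrite filter_uniq ?iota_uniq.
apply/allP => p; rewrite mem_filter mem_index_iota => /and3P[pr lt le].
have nfact c : c <= a -> ~~ (p %| c`!).
  move=> leca; rewrite fact_prod Euclid_dvd_prod // big_has_cond.
  apply/hasPn => i; rewrite mem_index_iota => /andP[i_gt0 ltic] /=.
  by rewrite gtnNdvd //; lia.
rewrite pr /= -(@Gauss_dvdl _ _ (b`! * a`!)).
  have := @bin_fact (a + b) b; rewrite leq_addl addnK => /(_ isT)->.
  by rewrite dvdn_fact // prime_gt0.
by rewrite coprimeMr !prime_coprime // !nfact.
Qed.

Lemma bin_le_exp2 n k : 'C(n, k) <= 2 ^ n.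
Proof.
elim: n k => [|n IH] [|k] //; first by rewrite bin0 expn_gt0.
by rewrite binS expnS mul2n -addnn leq_add.
Qed.

Lemma primorial_le n : primorial n <= 8 ^ n.
Proof.
have [k] := ubnP n; elim: k n => // k IH n le.
case: (leqP n 1) => [|n_gt1].
  by case: n {le} => [|[|//]] _; rewrite /primorial unlock.
have lehu : n./2 <= uphalf n by rewrite uphalf_half leq_addl.
have e : n = uphalf n + n./2 by rewrite uphalf_half -addnA addnn odd_double_half.
rewrite {1}e; apply: leq_trans (primorial_bin _ _ lehu) _; rewrite -e.
have ltu : uphalf n < k by lia.
apply: leq_trans (leq_mul (IH _ ltu) (bin_le_exp2 _ _)) _.
(* What remains is [3 * uphalf n <= 2 * n], true from [n = 2] on with equality at [n = 3]; so this
   induction needs the base 8. *)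
by rewrite -[8]/(2 ^ 3) -!expnM -expnD leq_exp2l //; lia.
Qed.

Definition primepi n := \sum_(0 <= p < n.+1 | prime p) 1.

(** By Legendre's formula the valuation is the sum over [j] of [n.*2 %/ p ^ j] minus twice
    [n %/ p ^ j]. Each term is 0 or 1, and it vanishes once [p ^ j] exceeds [n.*2]. *)
Lemma pfactor_central_bin_le p n : 0 < n -> p ^ logn p 'C(n.*2, n) <= n.*2.
Proof.
move=> n_gt0; case: (boolP (prime p)) => [pr|npr]; last first.
  by rewrite lognE (negPf npr) double_gt0.
have p_gt1 := prime_gt1 pr.
have [k ltk lek] : exists2 k, n.*2 < p ^ k.+1 & p ^ k <= n.*2.
  exists (trunc_log p n.*2); first exact: trunc_log_ltn.
  by rewrite trunc_logP ?double_gt0.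
apply: leq_trans lek; rewrite leq_exp2l //.
have e : logn p (n.*2)`! = logn p 'C(n.*2, n) + (logn p n`!).*2.
  have le : n <= n.*2 by rewrite -addnn leq_addl.
  have sub : n.*2 - n = n by rewrite -addnn addnK.
  rewrite -(bin_fact le) sub !lognM ?muln_gt0 ?fact_gt0 ?bin_gt0 //.
  by rewrite addnn.
have wide m : m <= n.*2 -> logn p m`! = \sum_(1 <= j < n.*2.+1) m %/ p ^ j.
  move=> lem; rewrite logn_fact // [RHS](@big_cat_nat _ _ _ m.+1) //= [X in _ = _ + X]big_nat.
  rewrite [X in _ = _ + X]big1 ?addn0 // => j /andP[ltmj _].
  by rewrite divn_small // (leq_trans ltmj) // ltnW // ltn_expl.
have := e; rewrite !wide -?addnn ?leq_addl // -big_split /= addnn.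
set S1 := \sum_(_ <= _ < _) _; set S2 := \sum_(_ <= _ < _) _ => e1.
suff : S1 <= k + S2 by lia.
apply: leq_trans (_ : \sum_(1 <= j < n.*2.+1) ((j <= k) + (n %/ p ^ j + n %/ p ^ j)) <= _).
  apply: leq_sum => j _; case: (leqP j k) => [_|ltkj] /=; last first.
    by rewrite divn_small // (leq_trans ltk) // leq_exp2l.
  have p_gt0 : 0 < p ^ j by rewrite expn_gt0 ltnW.
  rewrite -[leqRHS]addn1 -ltnS addnC -addSn [ltnRHS]addnC.
  rewrite ltn_divLR //.
  have := divn_eq n (p ^ j); have := ltn_pmod n p_gt0; nia.
rewrite big_split leq_add2r /= -big_mkcond /=.
rewrite sum1_count -size_filter -[leqRHS](size_iota 1); apply: uniq_leq_size.
  by rewrite filter_uniq ?iota_uniq.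
by move=> j; rewrite mem_filter mem_index_iota mem_iota add1n => /and3P[lek ge1 _]; rewrite ge1.
Qed.

Lemma central_bin_le n : 0 < n -> 'C(n.*2, n) <= n.*2 ^ primepi n.*2.
Proof.
move=> n_gt0; have C_gt0 : 0 < 'C(n.*2, n) by rewrite bin_gt0 -addnn leq_addl.
rewrite [leqLHS]prod_primes //; apply: leq_trans (_ : \prod_(p <- primes 'C(n.*2, n)) n.*2 <= _).
  by apply: leq_prod => p _; apply: pfactor_central_bin_le.
rewrite big_const_seq count_predT iter_muln_1 leq_pexp2l ?double_gt0 //.
rewrite /primepi sum1_count -size_filter; apply: uniq_leq_size; first exact: primes_uniq.
move=> p; rewrite mem_filter mem_index_iota mem_primes /= ltnS => /and3P[pr _ dv].
rewrite pr /= leqNgt; apply: contraTN dv => lt.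
have le : n <= n.*2 by rewrite -addnn leq_addl.
apply: contraNN (_ : ~~ (p %| (n.*2)`!)); first by rewrite -(bin_fact le) => /dvdn_mulr->.
rewrite fact_prod Euclid_dvd_prod // big_has.
apply/hasPn => i; rewrite mem_index_iota => /andP[i_gt0 lti] /=.
by rewrite gtnNdvd //; apply: leq_ltn_trans lt.
Qed.

(** Each step at least doubles the coefficient: C(2n+2, n+1) = 2 C(2n+1, n) >= 2 C(2n, n). *)
Lemma central_bin_ge n : 2 ^ n <= 'C(n.*2, n).
Proof.
elim: n => // n IH; rewrite expnS doubleS.
have -> : 'C(n.*2.+2, n.+1) = ('C(n.*2.+1, n)).*2.
  have le : n.+1 <= n.*2.+1 by rewrite ltnS -addnn leq_addl.
  have sub : n.*2.+1 - n.+1 = n by lia.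
  by rewrite binS -(bin_sub le) sub addnn.
rewrite mul2n leq_double; apply: leq_trans IH _.
by case: n => // n; rewrite binS leq_addr.
Qed.

(** The cut-off [N] keeps the search finite; it loses nothing for [0 < n <= N], where [a ^ 2 %| n]
    forces [a <= N]. *)
Definition square_divisor_ge (M N n : nat) : bool :=
  has (fun a => a ^ 2 %| n) (index_iota M N.+1).

Lemma small_square_decomposition M N n : 0 < n <= N -> ~~ square_divisor_ge M N n ->
  exists a s, [/\ n = a ^ 2 * s, 0 < a <= M, 0 < s & forall p, logn p s <= 1].
Proof.
move=> /andP[n_gt0 leN] /hasPn sq.
have [a [s [ns sqs]]] := square_decomposition _ n_gt0.
have [a_gt0 s_gt0] : 0 < a /\ 0 < s.
  by move: n_gt0; rewrite ns muln_gt0 expn_gt0 orbF => /andP[].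
have an : a <= n.
  by rewrite ns (leq_trans (leq_pmulr a a_gt0)) // mulnn leq_pmulr.
exists a, s; split; rewrite ?a_gt0 //= leqNgt; apply/negP => lt; have := sq a.
rewrite mem_index_iota ltnW // ltnS (leq_trans an leN) => /(_ isT).
by rewrite ns dvdn_mulr.
Qed.

(** * Unordered factorisations *)

Lemma leq_f (T : choiceType) (E : {fset T}) n (g : T -> {mset nat}) :
  {in E &, injective g} -> (forall e, e \in E -> factorisations n (g e)) ->
  #|` E| <= f n.
Proof.
move=> g_inj gF; rewrite -(card_in_imfset imfset_key g_inj); apply: fsubset_leq_card.
apply/fsubsetP => _ /imfsetP[e /= eE ->].
by rewrite in_fset_set ?inE; [apply: gF | apply: finite_factorisations].
Qed.

Lemma prod_seq_mset (s : seq nat) : \prod_(d <- seq_mset s) d = \prod_(d <- s) d.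
Proof. exact: perm_big (perm_eq_seq_mset s). Qed.

Lemma f_prime p : prime p -> f p = 1.
Proof.
move=> pr; rewrite /f (_ : factorisations p = [set seq_mset [:: p]]%classic).
  by rewrite fset_set1 cardfs1.
apply/seteqP; split=> A /=; last first.
  move=> ->; split=> [d|]; rewrite ?prod_seq_mset ?big_seq1 //.
  by rewrite (perm_mem (perm_eq_seq_mset _)) inE => /eqP->; apply: prime_gt1.
case=> gt1 prodA; rewrite -(seq_mset_id A); congr seq_mset.
have {gt1} gt1 : forall d, d \in (A : seq nat) -> 1 < d by [].
case: (A : seq nat) gt1 prodA => [|a s] gt1.
  by rewrite big_nil => e; move: pr; rewrite -e.
rewrite big_cons => e; have a_gt1 := gt1 a (mem_head _ _).
have : a %| p by rewrite -e dvdn_mulr.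
move/prime_nt_dvdP: (pr) => h; have {h} := h a => h.
case/primeP: pr => p1 pr /pr /orP[/eqP a1|/eqP ap]; first by rewrite a1 in a_gt1.
rewrite ap; congr (_ :: _).
have : \prod_(d <- s) d = 1.
  by apply/eqP; rewrite -(@eqn_pmul2l a) ?muln1 ?e ?ap // ltnW.
case: s gt1 {e} => // b s gt1; rewrite big_cons => /eqP; rewrite muln_eq1 => /andP[/eqP b1 _].
by have := gt1 b; rewrite b1 !inE eqxx orbT => /(_ isT).
Qed.

Lemma prod_logn_supset ps d : 0 < d -> uniq ps -> {subset primes d <= ps} ->
  \prod_(p <- ps) p ^ logn p d = d.
Proof.
move=> d_gt0 ups sub; rewrite (bigID (mem (primes d))) /= [X in _ * X]big1 ?muln1; last first.
  by move=> p; rewrite -logn_gt0 -eqn0Ngt => /eqP->.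
rewrite [RHS]prod_primes // -big_filter; apply: perm_big; apply: uniq_perm.
- by rewrite filter_uniq.
- exact: primes_uniq.
by move=> p; rewrite mem_filter; apply/andb_idr => /sub.
Qed.

Lemma logn_prod (I : Type) (r : seq I) (F : I -> nat) p :
  (forall i, 0 < F i) -> logn p (\prod_(i <- r) F i) = \sum_(i <- r) logn p (F i).
Proof.
move=> F_gt0; elim: r => [|a r IH]; first by rewrite !big_nil logn1.
by rewrite !big_cons lognM // ?IH // prodn_gt0.
Qed.

Lemma logn_prod_nth qs k (e : nat -> nat) i : k = size qs -> uniq qs ->
  all prime qs -> i < k ->
  logn (nth 0 qs i) (\prod_(j < k) nth 0 qs j ^ e j) = e i.
Proof.
move=> -> uqs /allP prq ltik.
have pr j : j < size qs -> prime (nth 0 qs j) by move=> lt; apply/prq/mem_nth.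
rewrite logn_prod => [|j]; last by rewrite expn_gt0 prime_gt0 ?pr.
rewrite (bigD1 (Ordinal ltik)) //= big1 => [|j /eqP neq].
  by rewrite addn0 pfactorK ?pr.
rewrite lognX logn_prime ?pr // nth_uniq // (_ : (_ == _) = false) ?muln0 //.
by apply/eqP => e'; apply: neq; apply/val_inj.
Qed.

(** Once the primes are sorted by exponent, replacing the j-th prime of [n] by the j-th prime of
    [n'] is a multiplicative map [phi] taking [n] to [n']. It is injective on the divisors of [n],
    with left inverse [psi], so applying it to every factor embeds the factorisations of [n] into
    those of [n']. *)
Lemma leq_f_of_exponents n n' : 0 < n -> 0 < n' ->
  perm_eq [seq logn p n | p <- primes n] [seq logn p n' | p <- primes n'] ->
  f n <= f n'.
Proof.
move=> n_gt0 n'_gt0 /perm_sortP eqs.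
have {eqs} := eqs _ leq_total leq_trans anti_leq.
rewrite (sort_map (primes n)) (sort_map (primes n')).
set ps := sort _ _; set qs := sort _ _ => eqs.
have ups : uniq ps by rewrite sort_uniq primes_uniq.
have uqs : uniq qs by rewrite sort_uniq primes_uniq.
have prp : all prime ps by apply/allP => p; rewrite mem_sort mem_primes => /and3P[].
have prq : all prime qs by apply/allP => p; rewrite mem_sort mem_primes => /and3P[].
have szE : size ps = size qs by have := congr1 size eqs; rewrite !size_map.
have eqe i : i < size ps -> logn (nth 0 ps i) n = logn (nth 0 qs i) n'.
  move=> lt; have := congr1 (fun s => nth 0 s i) eqs.
  by rewrite !(nth_map 0) -?szE.
pose phi d := \prod_(j < size ps) nth 0 qs j ^ logn (nth 0 ps j) d.
pose psi d := \prod_(j < size ps) nth 0 ps j ^ logn (nth 0 qs j) d.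
have phi_gt0 d : 0 < phi d.
  apply: prodn_gt0 => j; rewrite expn_gt0 prime_gt0 //.
  by apply: (allP prq); rewrite mem_nth // -szE.
have phiK d : d %| n -> psi (phi d) = d.
  move=> dv; have d_gt0 := dvdn_gt0 n_gt0 dv.
  rewrite -[RHS](@prod_logn_supset ps) //; last first.
    move=> p; rewrite mem_sort !mem_primes n_gt0 => /and3P[-> _ /= pd].
    exact: dvdn_trans dv.
  rewrite (big_nth 0) big_mkord; apply: eq_bigr => j _.
  by rewrite (@logn_prod_nth _ _ (fun j => logn (nth 0 ps j) d)).
have phin : phi n = n'.
  rewrite -[RHS](@prod_logn_supset qs) //; last by move=> p; rewrite mem_sort.
  rewrite (big_nth 0) big_mkord -szE; apply: eq_bigr => j _.
  by rewrite eqe.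
have phi1 : phi 1 = 1 by rewrite /phi big1 // => j _; rewrite logn1.
have phiM c d : 0 < c -> 0 < d -> phi (c * d) = phi c * phi d.
  move=> c0 d0; rewrite /phi -big_split; apply: eq_bigr => j _ /=.
  by rewrite lognM // expnD.
have phi_prod (s : seq nat) : (forall d, d \in s -> 1 < d) ->
    \prod_(d <- [seq phi d | d <- s]) d = phi (\prod_(d <- s) d).
  elim: s => [|a s IH] gt1; first by rewrite !big_nil phi1.
  rewrite /= !big_cons phiM; [|exact/ltnW/gt1/mem_head|].
    by rewrite IH // => d ds; apply: gt1; rewrite inE ds orbT.
  rewrite big_seq; apply: prodn_cond_gt0 => d ds.
  by apply/ltnW/gt1; rewrite inE ds orbT.
have fF A : A \in fset_set (factorisations n) -> factorisations n A.
  by rewrite in_fset_set ?inE //; apply: finite_factorisations.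
have dvF A d : factorisations n A -> d \in A -> d %| n.
  by move=> [_ <-] dA; rewrite (big_rem d) //= dvdn_mulr.
apply: (@leq_f _ (fset_set (factorisations n)) n' (fun A : {mset nat} => seq_mset [seq phi d | d <- A])).
  move=> A A' /fF FA /fF FA' /eq_seq_msetP /(perm_map psi).
  rewrite -!map_comp => peq; rewrite -(seq_mset_id A) -(seq_mset_id A').
  apply/eq_seq_msetP; have EM (M : {mset nat}) : factorisations n M -> map (psi \o phi) M = M.
    by move=> FM; apply: map_id_in => d /(dvF _ _ FM); apply: phiK.
  by rewrite !EM in peq.
move=> A /fF FA; split.
  move=> d; rewrite (perm_mem (perm_eq_seq_mset _)) => /mapP[c cA ->].
  (* No factor collapses to 1: [phi c = 1 = phi 1] would give [c = 1] after applying [psi]. *)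
  rewrite ltn_neqAle eq_sym phi_gt0 andbT; apply/eqP => phic1.
  have c1 : c = 1.
    by rewrite -[LHS](phiK _ (dvF _ _ FA cA)) phic1 -[RHS](phiK _ (dvd1n n)) phi1.
  by have := FA.1 _ cA; rewrite c1.
apply: etrans (prod_seq_mset _) _; rewrite phi_prod; first by rewrite FA.2 phin.
exact: FA.1.
Qed.

Lemma eq_f_of_exponents n n' : 0 < n -> 0 < n' ->
  perm_eq [seq logn p n | p <- primes n] [seq logn p n' | p <- primes n'] ->
  f n = f n'.
Proof.
move=> n_gt0 n'_gt0 peq; apply/eqP; rewrite eqn_leq !leq_f_of_exponents //.
by rewrite perm_sym.
Qed.

Lemma pfactor_primes n p q : p \in primes n -> q \in primes n ->
  (p %| q ^ logn q n) = (p == q).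
Proof.
rewrite -[q \in _]logn_gt0 !mem_primes => /and3P[prp _ _] nq.
have prq : prime q by move: nq; rewrite lognE; case: prime.
by rewrite Euclid_dvdX // nq andbT dvdn_prime2.
Qed.

(* Fix m of the prime powers exactly dividing n, one in each factor; every way
   of distributing the other ones gives a different factorisation. *)
Lemma exp_le_f m n : 0 < n -> 0 < m <= omega n -> m ^ (omega n - m) <= f n.
Proof.
move=> n_gt0 /andP[m_gt0 lem].
set k := omega n - m; have szE : omega n = m + k by rewrite subnKC.
pose P (i : 'I_(m + k)) := nth 0 (primes n) i.
have PP i : P i \in primes n by rewrite mem_nth // -[size _]/(omega n) szE.
pose Q i := P i ^ logn (P i) n.
have PQ i j : (P i %| Q j) = (i == j).
  rewrite pfactor_primes // nth_uniq ?primes_uniq // -[size _]/(omega n) szE //.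
have Q_gt1 i : 1 < Q i.
  have := PP i; rewrite /Q -logn_gt0; case: (logn _ _) => // e _.
  have := PP i; rewrite mem_primes => /and3P[/prime_gt1 gt1 _ _].
  by rewrite -(exp1n e.+1) ltn_exp2r.
have prodQ : \prod_i Q i = n.
  by rewrite [RHS]prod_primes // (big_nth 0) big_mkord -[size _]/(omega n) szE.
(* The first [m] prime powers label the [m] factors; [g] assigns each of the [k] others to a
   factor. *)
pose d (g : {ffun 'I_k -> 'I_m}) (j : 'I_m) :=
  Q (lshift k j) * \prod_(i | g i == j) Q (rshift m i).
have Pd g j i : P (lshift k i) %| d g j -> i = j.
  rewrite Euclid_dvdM ?PQ; last by have := PP (lshift k i); rewrite mem_primes => /and3P[].
  rewrite (inj_eq (@lshift_inj _ _)) => /orP[/eqP//|].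
  rewrite Euclid_dvd_prod ?big_has_cond; last by have := PP (lshift k i); rewrite mem_primes => /and3P[].
  by move=> /hasP[l _ /andP[_]]; rewrite PQ eq_lrshift.
have Pd' g j i : (P (rshift m i) %| d g j) = (g i == j).
  have pr : prime (P (rshift m i)) by have := PP (rshift m i); rewrite mem_primes => /and3P[].
  rewrite Euclid_dvdM // PQ eq_rlshift /= Euclid_dvd_prod // big_has_cond.
  apply/hasP/idP => [[l _ /andP[gl]]|gi]; last by exists i; rewrite ?mem_index_enum //= gi PQ eqxx.
  by rewrite PQ (inj_eq (@rshift_inj _ _)) => /eqP->.
have := @leq_f _ [fset g in {: {ffun 'I_k -> 'I_m}}]%fset n
  (fun g => seq_mset [seq d g j | j <- enum 'I_m]).
rewrite card_finset -[#|_|]/#|{: {ffun 'I_k -> 'I_m}}| card_ffun !card_ord; apply.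
  (* To recover [g i], take the factor divisible by the prime [P (rshift m i)] and read off its
     label, the only prime of index below [m] dividing it. *)
  move=> g g' _ _ /eq_seq_msetP /perm_mem peq; apply/ffunP => i; apply/eqP.
  have /mapP[j' _ dd] : d g (g i) \in [seq d g' j | j <- enum 'I_m].
    by rewrite -peq map_f // mem_enum.
  have := Pd' g (g i) i; rewrite eqxx dd Pd' => /eqP->.
  apply/eqP; apply: (Pd g'); rewrite -dd dvdn_mulr //.
  have := PQ (lshift k (g i)) (lshift k (g i)); rewrite eqxx //.
move=> g _; split=> [c|].
  rewrite (perm_mem (perm_eq_seq_mset _)) => /mapP[j _ ->].
  rewrite (leq_trans (Q_gt1 (lshift k j))) // leq_pmulr //.
  by apply: prodn_cond_gt0 => i _; apply: ltnW.
apply: etrans (prod_seq_mset _) _; rewrite big_map big_enum /=.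
rewrite big_split /= -[RHS]prodQ big_split_ord /=; congr (_ * _).
by rewrite [RHS](partition_big g xpredT).
Qed.

(** * Coding the exponent multiset by boundedly many values *)

(** The default value 0 of [nth] pads a positive list to length [s]; filtering out the zeros
    recovers it, so [s] recorded values determine the list. *)
Lemma filter_mkseq_nth s (L : seq nat) : all (fun x => 0 < x) L -> size L <= s ->
  [seq x <- mkseq (nth 0 L) s | 0 < x] = L.
Proof.
elim: s L => [|s IH] [|a L] //=.
  move=> _ _; rewrite /mkseq /= (eq_map (g := fun=> 0)); last by case.
  by rewrite (eq_in_filter (a2 := pred0)) ?filter_pred0 // => _ /mapP[x _ ->].
move=> /andP[a_gt0 aL]; rewrite ltnS => szL; rewrite /mkseq /= a_gt0; congr (_ :: _).
by rewrite -[RHS](IH L) // /mkseq (iotaDl 1 0) -map_comp.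
Qed.

Definition exponents n := [seq logn p n | p <- primes n].

(* If the exponents sum to M < (s + 1) ^ 2, then at most s of them exceed s: it is
   enough to record the multiplicities of the others and a list of length s. *)
Definition exponent_code s M n : {ffun 'I_s.+1 -> 'I_M.+1} * {ffun 'I_s -> 'I_M.+1} :=
  ([ffun i : 'I_s.+1 => inord (count_mem (i : nat) (exponents n))],
   [ffun i : 'I_s => inord (nth 0 [seq e <- exponents n | s < e] i)]).

Lemma sumn_exponents n : \sum_(e <- exponents n) e = bigomega n.
Proof. by rewrite big_map. Qed.

Lemma mul_size_filter_gt s (L : seq nat) :
  size [seq e <- L | s < e] * s.+1 <= \sum_(e <- L) e.
Proof.
elim: L => [|a L IH]; first by rewrite big_nil.
rewrite big_cons /=; case: ltnP => [lt|_] /=; last by rewrite (leq_trans IH) ?leq_addl.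
by rewrite mulSn leq_add.
Qed.

Lemma exponents_gt0 n : all (fun x => 0 < x) (exponents n).
Proof. by apply/allP => _ /mapP[p pn ->]; rewrite logn_gt0. Qed.

Lemma omega_le_bigomega n : omega n <= bigomega n.
Proof.
by rewrite /omega -sum1_size /bigomega !big_seq leq_sum // => p; rewrite logn_gt0.
Qed.

Lemma f_exponent_code s M n n' : M < s.+1 ^ 2 -> 0 < n -> 0 < n' ->
  bigomega n <= M -> bigomega n' <= M ->
  exponent_code s M n = exponent_code s M n' -> f n = f n'.
Proof.
move=> ltM n_gt0 n'_gt0 leM leM' [/ffunP E1 /ffunP E2].
(* Multiplicities and exponents are all at most [M], so the [inord] in the code loses no
   information. *)
have count_le m v : bigomega m <= M -> count_mem v (exponents m) < M.+1.
  move=> le; rewrite ltnS (leq_trans (count_size _ _)) // size_map.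
  exact: leq_trans (omega_le_bigomega m) le.
have mem_le m e : bigomega m <= M -> e \in exponents m -> e <= M.
  by move=> le em; apply: leq_trans le; rewrite -sumn_exponents (big_rem e) //= leq_addr.
have nth_le m i : bigomega m <= M -> nth 0 [seq e <- exponents m | s < e] i < M.+1.
  move=> le; case: (ltnP i (size [seq e <- exponents m | s < e])) => [lt|ge].
    by have := mem_nth 0 lt; rewrite mem_filter => /andP[_ /(mem_le _ _ le)].
  by rewrite nth_default.
(* More than [s] exponents exceeding [s] would sum to at least [s.+1 ^ 2 > M]. *)
have size_le m : bigomega m <= M -> size [seq e <- exponents m | s < e] <= s.
  move=> le; have := mul_size_filter_gt s (exponents m); rewrite sumn_exponents => le'.
  rewrite -ltnS -(@ltn_pmul2r s.+1) //; apply: leq_ltn_trans (leq_trans le' le) _.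
  by rewrite mulnn.
have large : [seq e <- exponents n | s < e] = [seq e <- exponents n' | s < e].
  have pos m : all (fun x => 0 < x) [seq e <- exponents m | s < e].
    by apply/allP => e; rewrite mem_filter => /andP[_]; apply: (allP (exponents_gt0 m)).
  rewrite -(@filter_mkseq_nth s _ (pos n)) ?size_le //.
  rewrite -[RHS](@filter_mkseq_nth s _ (pos n')) ?size_le //; congr (seq.filter _ _).
  apply/eq_in_map => i; rewrite mem_iota add0n /= => lt.
  have := E2 (Ordinal lt); rewrite !ffunE /= => /(congr1 val) /=.
  by rewrite !inordK // ?nth_le.
apply: eq_f_of_exponents => //; apply/allP => v _ /=; apply/eqP.
case: (ltnP v s.+1) => [lt|gt].
  have := E1 (Ordinal lt); rewrite !ffunE /= => /(congr1 val) /=.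
  by rewrite !inordK ?count_le.
have cf m : count_mem v (exponents m) = count_mem v [seq e <- exponents m | s < e].
  rewrite count_filter; apply: eq_count => e /=.
  by case: eqP => //= ->.
by rewrite -!/(exponents _) !cf large.
Qed.

(** * Subpolynomial growth *)

Lemma leq_wexp2r m n e : m <= n -> m ^ e <= n ^ e.
Proof. by case: e => // e le; rewrite leq_exp2r. Qed.

(** With [r = s %/ (2 * k)], one has [s.+1 <= 2 * k * r.+1 <= 2 ^ (2 * k + r)]. In the k-th power
    the exponent is 2k^2 + rk, and each summand is at most s / 2. *)
Lemma poly_le_exp2 k s : 0 < k -> 4 * k ^ 2 <= s -> s.+1 ^ k <= 2 ^ s.
Proof.
move=> k_gt0 les; pose r := s %/ (2 * k).
have rs : r * (2 * k) <= s by apply: leq_trunc_div.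
have s1 : s.+1 <= 2 ^ (2 * k + r).
  apply: leq_trans (_ : 2 * k * r.+1 <= _).
    by rewrite mulnC -ltnS ltnS ltn_ceil // muln_gt0.
  have le2k : 2 * k <= 2 ^ (2 * k) by apply/ltnW/ltn_expl.
  have ler : r < 2 ^ r by apply: ltn_expl.
  by rewrite expnD; apply: leq_mul.
apply: leq_trans (leq_wexp2r _ _ _ s1) _ => //.
rewrite -expnM leq_exp2l // -(@leq_pmul2l 2) //.
have -> : 2 * ((2 * k + r) * k) = 4 * k ^ 2 + r * (2 * k) by rewrite -mulnn; lia.
by rewrite [2 * s]mul2n -addnn leq_add.
Qed.

Lemma leq_root_exp2 a m Q : 0 < Q -> a ^ Q <= 2 ^ m -> a <= 2 ^ (m %/ Q).+1.
Proof.
move=> Q_gt0 le; rewrite leqNgt; apply/negP => lt.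
have : (2 ^ (m %/ Q).+1) ^ Q < 2 ^ m by apply: leq_trans le; rewrite ltn_exp2r.
by rewrite -expnM ltn_exp2l // ltnNge ltnW // ltn_ceil.
Qed.

Lemma exists_sqrtn m : exists s, s ^ 2 <= m < s.+1 ^ 2.
Proof.
elim: m => [|m [s /andP[le lt]]]; first by exists 0.
case: (ltnP m.+1 (s.+1 ^ 2)) => [lt'|ge].
  by exists s; rewrite lt' andbT leqW.
by exists s.+1; rewrite ge /=; apply: leq_ltn_trans lt _; rewrite ltn_exp2r.
Qed.

(** This fixes the parameters of [count_upper_bound], whose bracket appears here: with [2 ^ t] of
    the order of ln x, the bound [2 ^ (t %/ q)] is at most (ln x)^(1/q). With [u = t %/ q], each of
    the three summands is shown to be at most [2 ^ (u - 2)]. *)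
Lemma subpolynomial_bound q : 0 < q -> exists b c t0, 0 < b /\ forall t, t0 <= t ->
  exists2 s, 4 * t + 1 < s.+1 ^ 2 &
    6 + 2 * (4 * t + 2) ^ (2 * s + 1)
      + 16 * 2 ^ (c * (2 ^ b + t %/ b) + ((c + t + 2) %/ 2 ^ c).+1) <= 2 ^ (t %/ q).
Proof.
(* The factor [8 * q] in [b] gives [8 * c * (t %/ b) <= u]; since [2 ^ c > c = 8 * q], the root term
   [Y] also stays near [u / 8]. *)
move=> q_gt0; pose c := 8 * q; pose b := 8 * q * c.
have c_gt0 : 0 < c by rewrite /c muln_gt0.
have b_gt0 : 0 < b by rewrite /b !muln_gt0 q_gt0.
(* [Z] is the threshold of [poly_le_exp2] for the power [48 * q], and [u0] absorbs the terms
   independent of [t]. The third witness below ensures [Z <= s] and [u0 <= u]. *)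
pose Z := 4 * (48 * q) ^ 2.
pose u0 := 2 * (c * 2 ^ b) + c + 20.
exists b, c, (Z ^ 2 + Z + u0 * q); split=> // t let0.
pose u := t %/ q; have ltu : t < u.+1 * q by apply: ltn_ceil.
have u_ge : u0 <= u by rewrite leq_divRL //; lia.
have [s /andP[les lts]] := exists_sqrtn (4 * t + 1).
exists s => //.
have Zs : Z <= s.
  have: Z ^ 2 < s.+1 ^ 2 by apply: leq_ltn_trans lts; lia.
  by rewrite ltn_exp2r.
set X := c * (t %/ b); set Y := (c + t + 2) %/ 2 ^ c.
have X8 : 8 * X <= u.
  have : t %/ b * b <= t by apply: leq_trunc_div.
  have -> : t %/ b * b = 8 * X * q by rewrite /X /b; lia.
  move=> le; rewrite -ltnS -(@ltn_pmul2r q) //; exact: leq_ltn_trans le ltu.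
have Y8 : 8 * Y <= u + c + 2.
  have : Y * 2 ^ c <= c + t + 2 by apply: leq_trunc_div.
  have : 8 * Y * q <= Y * 2 ^ c.
    have -> : 8 * Y * q = Y * c by rewrite /c; lia.
    by rewrite leq_mul2l; apply/orP; right; apply/ltnW/ltn_expl.
  move=> h1 h2; rewrite -ltnS -(@ltn_pmul2r q) //.
  have -> : (u + c + 2).+1 * q = u.+1 * q + (c + 2) * q by rewrite -mulnDl addSn addnA.
  apply: leq_ltn_trans (leq_trans h1 h2) _.
  by rewrite addnAC addnC -addSn leq_add // leq_pmulr.
have P1 : 2 * (4 * t + 2) ^ (2 * s + 1) <= 2 ^ (u - 2).
  have s_gt0 : 0 < s by apply: leq_trans Zs; rewrite muln_gt0 expn_gt0 muln_gt0 q_gt0.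
  (* As [4 * t + 2 <= s.+1 ^ 2], [A] dominates the number of codes. Its power [8 * q] is the s-th
     power of [s.+1 ^ (48 * q) <= 2 ^ s], hence at most [2 ^ (4 * t + 1)]; so [A] is about
     2^(t/(2q)) at most. *)
  pose A := s.+1 ^ (6 * s).
  have AQ : A ^ (8 * q) <= 2 ^ (4 * t + 1).
    have kq : 0 < 48 * q by rewrite muln_gt0.
    rewrite /A -expnM (_ : 6 * s * (8 * q) = (48 * q) * s); last by lia.
    rewrite expnM; apply: leq_trans (leq_wexp2r _ _ _ (poly_le_exp2 _ _ kq Zs)) _ => //.
    by rewrite -expnM leq_exp2l // mulnn.
  have leA : (4 * t + 2) ^ (2 * s + 1) <= A.
    apply: leq_trans (_ : (s.+1 ^ 2) ^ (2 * s + 1) <= _).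
      by apply/leq_wexp2r/(leq_trans _ lts); rewrite addn1 addn2.
    by rewrite -expnM leq_exp2l //; move: s_gt0; clear; lia.
  have {}AQ := leq_root_exp2 _ _ _ c_gt0 AQ.
  apply: leq_trans (leq_mul (leqnn 2) (leq_trans leA AQ)) _.
  rewrite -expnS leq_exp2l //.
  have : (4 * t + 1) %/ c * c <= 4 * t + 1 by apply: leq_trunc_div.
  set w := (4 * t + 1) %/ c => hw.
  have : 2 * w <= u + 1.
    rewrite -ltnS -(@ltn_pmul2r (4 * q)) ?muln_gt0 //.
    have e1 : 2 * w * (4 * q) = w * c by rewrite /c; clear; lia.
    have e2 : 4 * t + 1 < (u + 1).+1 * (4 * q).
      by move: ltu q_gt0; clear; move: (u) (q) => v p; nia.
    by rewrite e1; apply: leq_ltn_trans e2.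
  have : 20 <= u by move: u_ge; rewrite /u0; clear; lia.
  by clear; move: (w) (u) => w' v; lia.
have P2 : 16 * 2 ^ (c * (2 ^ b + t %/ b) + Y.+1) <= 2 ^ (u - 2).
  rewrite -[16]/(2 ^ 4) -expnD leq_exp2l // mulnDr -/X.
  move: u_ge X8 Y8; rewrite /u0; clear; move: (c * 2 ^ b) (c) (u) (X) (Y) => W c' v X' Y'; lia.
have P3 : 6 <= 2 ^ (u - 2).
  by apply: leq_trans (_ : 2 ^ 3 <= _) => //; rewrite leq_exp2l //; move: u_ge; rewrite /u0; clear; lia.
have -> : 2 ^ (t %/ q) = 4 * 2 ^ (u - 2).
  by rewrite -[4]/(2 ^ 2) -expnD subnKC //; move: u_ge; rewrite /u0; clear; lia.
apply: leq_trans (leq_add (leq_add P3 P1) P2) _.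
by move: (2 ^ (u - 2)); clear; lia.
Qed.

(** * Sums over integers *)

Local Open Scope ring_scope.

Section Sums.
Context {R : realType}.

Lemma sum_delta (N u : nat) :
  \sum_(1 <= n < N.+1) ((u == n)%:R : R) = (0 < u <= N)%N%:R.
Proof.
case: (boolP (0 < u <= N)%N) => [u_in|u_out].
  rewrite (bigD1_seq u) ?iota_uniq ?mem_index_iota ?ltnS //= eqxx big1 ?addr0 //.
  by move=> n /negPf; rewrite eq_sym => ->.
rewrite big_nat big1 // => n n_in; case: eqP => // un.
by rewrite un -ltnS n_in in u_out.
Qed.

Lemma sum_inv_sqr (M N : nat) : (0 < M)%N ->
  \sum_(M <= a < N.+1) ((a ^ 2)%:R^-1 : R) <= 2 / M%:R.
Proof.
move=> M_gt0; case: (leqP N.+1 M) => [le|]; first by rewrite big_geq // divr_ge0.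
rewrite ltnS => /subnKC <-; set k := (N - M)%N.
(* Subtracting the tail makes the induction telescope: 1/(y+1)^2 <= 1/y - 1/(y+1). *)
suff : \sum_(M <= a < (M + k).+1) ((a ^ 2)%:R^-1 : R) <= 2 / M%:R - (M + k)%:R^-1.
  by move/le_trans; apply; rewrite gerBl invr_ge0.
have M_ge1 : (1 : R) <= M%:R by rewrite ler1n.
elim: k => [|k IH].
  rewrite addn0 big_nat1 natrX.
  have -> : 2 / M%:R - M%:R^-1 = M%:R^-1 :> R by lra.
  by rewrite lef_pV2 ?posrE ?exprn_gt0 ?ltr0n // ler_eXnr.
rewrite addnS big_nat_recr /=; last by lia.
apply: le_trans (lerD IH (lexx _)) _.
have: (0 : R) < (M + k)%:R by rewrite ltr0n; lia.
rewrite natrX -[(M + k).+1%:R]natr1; set y : R := (M + k)%:R => y_gt0.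
rewrite -addrA lerD2l -subr_ge0.
have -> : - (y + 1)^-1 - (- y^-1 + ((y + 1) ^+ 2)^-1) = (y * (y + 1) ^+ 2)^-1.
  by field; lra.
by rewrite invr_ge0 mulr_ge0 ?sqr_ge0 // ltW.
Qed.

Lemma inv_succ_le_ln (n : nat) : (0 < n)%N -> (n.+1%:R^-1 : R) <= ln n.+1%:R - ln n%:R.
Proof.
move=> n_gt0; have n0 : (0 : R) < n%:R by rewrite ltr0n.
have n1 : (0 : R) < n.+1%:R by rewrite ltr0n.
have := @le_ln1Dx R (- n.+1%:R^-1).
have -> : 1 + - n.+1%:R^-1 = n%:R / n.+1%:R :> R.
  by rewrite -[n.+1%:R]natr1 in n1 *; field; rewrite gt_eqF.
rewrite ln_div ?posrE // => h.
suff /h : -1 < - n.+1%:R^-1 :> R by rewrite lerNr opprB.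
by rewrite ltrN2 invf_lt1 // ltr1n.
Qed.

Lemma harmonic_le_ln (N : nat) : (0 < N)%N ->
  \sum_(1 <= n < N.+1) (n%:R^-1 : R) <= 1 + ln N%:R.
Proof.
case: N => // N _; elim: N => [|N IH]; first by rewrite big_nat1 invr1 ln1 addr0.
rewrite big_nat_recr //=; apply: le_trans (lerD IH (inv_succ_le_ln N.+1 isT)) _.
by rewrite -addrA [ln N.+1%:R + _]addrC subrK.
Qed.

Lemma sum_dvdn d N : (0 < d)%N -> (\sum_(1 <= n < N.+1) (d %| n) = N %/ d)%N.
Proof.
move=> d_gt0; elim: N => [|N IH]; first by rewrite big_geq // div0n.
by rewrite big_nat_recr //= IH divnS // addnC.
Qed.

Lemma size_divisors_sum n N : (0 < n <= N)%N ->
  (size (divisors n) = \sum_(1 <= d < N.+1) (d %| n))%N.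
Proof.
move=> /andP[n_gt0 leN]; rewrite -big_mkcond sum1_count -size_filter; apply/perm_size.
apply: uniq_perm; rewrite ?divisors_uniq ?filter_uniq ?iota_uniq // => d.
rewrite mem_filter mem_index_iota -dvdn_divisors //; apply/esym/andb_idr => dv.
by rewrite (dvdn_gt0 n_gt0 dv) ltnS (leq_trans (dvdn_leq n_gt0 dv)).
Qed.

(** [2 ^ omega n] is at most the number of divisors of [n]; counting pairs [d %| n] by [d] first
    yields a harmonic sum. *)
Lemma sum_exp2_omega_le (N : nat) : (0 < N)%N ->
  \sum_(1 <= n < N.+1) ((2 ^ omega n)%:R : R) <= N%:R * (1 + ln N%:R).
Proof.
move=> N_gt0; apply: le_trans (_ : \sum_(1 <= n < N.+1) (size (divisors n))%:R <= _).
  rewrite big_nat [leRHS]big_nat; apply: ler_sum => n /andP[n_gt0 _].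
  by rewrite ler_nat exp2_omega_le.
rewrite -natr_sum.
have -> : (\sum_(1 <= n < N.+1) size (divisors n) = \sum_(1 <= d < N.+1) N %/ d)%N.
  rewrite big_nat (eq_bigr (fun n => \sum_(1 <= d < N.+1) (d %| n)))%N; last first.
    by move=> n; rewrite ltnS => /size_divisors_sum.
  rewrite -big_nat exchange_big big_nat [RHS]big_nat.
  by apply: eq_bigr => d /andP[d_gt0 _]; rewrite sum_dvdn.
rewrite natr_sum; apply: le_trans (ler_wpM2l _ (harmonic_le_ln _ N_gt0)) => //.
rewrite mulr_sumr big_nat [leRHS]big_nat; apply: ler_sum => d /andP[d_gt0 _].
by rewrite ler_pdivlMr ?ltr0n // -natrM ler_nat leq_trunc_div.
Qed.

(** * Sums over integers with few prime factors *)

Definition weighted_sum (z : R) (N : nat) : R :=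
  \sum_(1 <= m < N.+1) z ^+ bigomega m / m%:R.

(** The summand is completely multiplicative, and in the expanded square each [n] arises as [m * k]
    at most as often as it has divisors, that is at most [2 ^ bigomega n] times. *)
Lemma weighted_sum_sqr z N : 0 <= z -> weighted_sum z N ^+ 2 <= weighted_sum (2 * z) (N ^ 2).
Proof.
move=> z_ge0; rewrite /weighted_sum expr2 mulr_suml.
pose F n := z ^+ bigomega n / n%:R : R.
have F_ge0 n : 0 <= F n by rewrite divr_ge0 ?exprn_ge0.
apply: le_trans (_ : \sum_(1 <= m < N.+1) \sum_(1 <= k < N.+1)
    \sum_(1 <= n < (N ^ 2).+1) (m * k == n)%N%:R * F n <= _).
  rewrite big_nat [leRHS]big_nat; apply: ler_sum => m /andP[m_gt0 lem].
  rewrite mulr_sumr big_nat [leRHS]big_nat; apply: ler_sum => k /andP[k_gt0 lek].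
  rewrite (bigD1_seq (m * k)%N) ?iota_uniq //=; last first.
    by rewrite mem_index_iota muln_gt0 m_gt0 k_gt0 ltnS leq_mul.
  rewrite eqxx mul1r ler_wpDr ?sumr_ge0 // => [n _|]; first by rewrite mulr_ge0.
  by rewrite /F bigomegaM // exprD natrM invfM mulrACA.
under eq_bigr do rewrite exchange_big /=.
rewrite exchange_big /= big_nat [leRHS]big_nat; apply: ler_sum => n /andP[n_gt0 len].
under eq_bigr do rewrite -mulr_suml.
rewrite -mulr_suml exprMn -mulrA ler_wpM2r ?F_ge0 //.
apply: le_trans (_ : (size (divisors n))%:R <= _); last first.
  by rewrite -natrX ler_nat size_divisors_le.
rewrite (@size_divisors_sum n n) ?n_gt0 ?leqnn //.
apply: le_trans (_ : \sum_(1 <= m < N.+1) (m %| n)%N%:R <= _).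
  rewrite big_nat [leRHS]big_nat; apply: ler_sum => m /andP[m_gt0 _].
  case: (boolP (m %| n)%N) => [dv|ndv]; last first.
    by rewrite big1 // => k _; case: eqP => // e; rewrite -e dvdn_mulr in ndv.
  apply: le_trans (_ : \sum_(1 <= k < N.+1) (n %/ m == k)%N%:R <= _); last first.
    by rewrite sum_delta lern1; case: (_ && _).
  apply: ler_sum => k _; rewrite ler_nat; case: eqP => // e.
  by rewrite -e mulKn // eqxx.
rewrite -natr_sum ler_nat.
case: (leqP N n) => [le|lt]; first by rewrite [leqRHS](@big_cat_nat _ _ _ N.+1) //= leq_addr.
rewrite (@big_cat_nat _ _ _ n.+1) //=; last exact: ltnW.
rewrite [X in (_ + X)%N]big_nat [X in (_ + X)%N]big1 ?addn0 // => m /andP[ltm _].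
by rewrite gtnNdvd.
Qed.

Lemma weighted_sum_ge0 z N : 0 <= z -> 0 <= weighted_sum z N.
Proof. by move=> z_ge0; apply: sumr_ge0 => n _; rewrite divr_ge0 ?exprn_ge0. Qed.

(* d_r(n) <= r^Omega(n) for r = 2^c, reached by iterated squaring. *)
Lemma weighted_sum_le (c N : nat) : (0 < N)%N ->
  weighted_sum (2 ^- c) N ^+ (2 ^ c) <= 1 + (2 ^ c)%:R * ln N%:R.
Proof.
(* After [k = c] squarings the weight base has become 1, leaving a harmonic sum up to
   [N ^ 2 ^ c]. *)
move=> N_gt0; suff h k : (k <= c)%N ->
    weighted_sum (2 ^- c) N ^+ (2 ^ k) <= weighted_sum (2 ^- (c - k)) (N ^ (2 ^ k)).
  apply: le_trans (h c (leqnn _)) _; rewrite subnn expr0 invr1.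
  have Np_gt0 : (0 < N ^ 2 ^ c)%N by rewrite expn_gt0 N_gt0.
  have := harmonic_le_ln _ Np_gt0; rewrite natrX lnXn ?ltr0n // mulr_natl.
  apply: le_trans; rewrite /weighted_sum; apply: ler_sum => n _.
  by rewrite expr1n div1r.
elim: k => [|k IH] le; first by rewrite subn0 !expn0 expr1 expn1.
rewrite expnSr exprM.
apply: le_trans (_ : weighted_sum (2 ^- (c - k)) (N ^ 2 ^ k) ^+ 2 <= _).
  rewrite lerXn2r ?nnegrE ?exprn_ge0 ?weighted_sum_ge0 ?invr_ge0 ?exprn_ge0 //.
  exact: IH (ltnW le).
apply: le_trans (weighted_sum_sqr _ _ _) _; first by rewrite invr_ge0 exprn_ge0.
rewrite expnM; have -> : (c - k = (c - k.+1).+1)%N by lia.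
by rewrite exprS invfM mulrA divff ?mul1r.
Qed.

Definition few_primes_sum (K N : nat) : R :=
  \sum_(1 <= m < N.+1) (omega m <= K)%N%:R / m%:R.

(** Rankin's trick on the squarefree part: for [m = a ^ 2 * s], [bigomega s = omega s <= K], so
    [2 ^ (c * K)] times the weight of [s] is at least 1. The square parts contribute the factor
    2. *)
Lemma few_primes_sum_le (c K N : nat) :
  few_primes_sum K N <= (2 ^ (c * K))%:R * 2 * weighted_sum (2 ^- c) N.
Proof.
set z : R := 2 ^- c; have z_gt0 : 0 < z by rewrite invr_gt0 exprn_gt0.
have z_le1 : z <= 1 by rewrite invf_le1 ?exprn_gt0 // exprn_ege1 // ler1n.
pose F a s := (2 ^ (c * K))%:R * ((a ^ 2)%:R^-1 * (z ^+ bigomega s / s%:R)) : R.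
have F_ge0 a s : 0 <= F a s.
  by rewrite !mulr_ge0 ?invr_ge0 // exprn_ge0 // ltW.
rewrite /few_primes_sum; apply: le_trans (_ : \sum_(1 <= m < N.+1) \sum_(1 <= a < N.+1) \sum_(1 <= s < N.+1)
    (a ^ 2 * s == m)%N%:R * F a s <= _).
  rewrite big_nat [leRHS]big_nat; apply: ler_sum => m /andP[m_gt0 lem].
  case: leqP => [leK|_]; last first.
    by rewrite mul0r; do 2!(apply: sumr_ge0 => ? _); rewrite mulr_ge0.
  have [a [s [ms sqs]]] := square_decomposition _ m_gt0.
  have [a_gt0 s_gt0] : (0 < a)%N /\ (0 < s)%N.
    by move: m_gt0; rewrite ms muln_gt0 expn_gt0 orbF => /andP[].
  have sm : (s <= m)%N by rewrite ms leq_pmull // expn_gt0 a_gt0.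
  have am : (a <= m)%N.
    by rewrite ms (leq_trans (leq_pmulr a a_gt0)) // mulnn leq_pmulr.
  rewrite (bigD1_seq a) ?iota_uniq ?mem_index_iota ?a_gt0 //=; last exact: leq_ltn_trans am lem.
  rewrite ler_wpDr ?sumr_ge0 // => [i _|]; first by apply: sumr_ge0 => ? _; rewrite mulr_ge0.
  rewrite (bigD1_seq s) ?iota_uniq ?mem_index_iota ?s_gt0 //=; last exact: leq_ltn_trans sm lem.
  rewrite ler_wpDr ?sumr_ge0 // => [i _|]; first by rewrite mulr_ge0.
  rewrite -ms eqxx !mul1r.
  have -> : F a s = ((2 ^ (c * K))%:R * z ^+ bigomega s) * m%:R^-1 :> R.
    by rewrite /F ms natrM invfM; ring.
  rewrite ler_peMl ?invr_ge0 // /z -exprVn -exprM natrX exprVn.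
  rewrite ler_pdivlMr ?exprn_gt0 // mul1r ler_weXn2l ?ler1n // leq_mul2l.
  rewrite bigomega_sqf // (leq_trans _ leK) ?orbT // omega_dvdn //.
  by rewrite ms dvdn_mull.
rewrite exchange_big /=; under eq_bigr do rewrite exchange_big /=.
apply: le_trans (_ : \sum_(1 <= a < N.+1) \sum_(1 <= s < N.+1) F a s <= _).
  apply: ler_sum => a _; apply: ler_sum => s _.
  by rewrite -mulr_suml sum_delta ler_piMl // lern1; case: (_ && _).
rewrite /F; under eq_bigr do rewrite -mulr_sumr -mulr_sumr.
rewrite -mulr_sumr -mulrA ler_wpM2l // -mulr_suml ler_wpM2r ?(weighted_sum_ge0 _ _ (ltW z_gt0)) //.
by apply: le_trans (sum_inv_sqr 1 N isT) _; rewrite divr1.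
Qed.

Lemma sum_square_divisor_ge (M N : nat) : (0 < M)%N ->
  \sum_(1 <= n < N.+1) (square_divisor_ge M N n)%:R <= N%:R * (2 / M%:R) :> R.
Proof.
move=> M_gt0.
apply: le_trans (_ : \sum_(1 <= n < N.+1) \sum_(M <= a < N.+1) (a ^ 2 %| n)%N%:R <= _).
  apply: ler_sum => n _; case: (boolP (square_divisor_ge M N n)) => [/hasP[a aN dv]|_].
    by rewrite (bigD1_seq a) ?iota_uniq //= dv ler_wpDr // sumr_ge0.
  by rewrite sumr_ge0.
rewrite exchange_big /=; apply: le_trans (ler_wpM2l _ (sum_inv_sqr M N M_gt0)) => //.
rewrite mulr_sumr big_nat [leRHS]big_nat; apply: ler_sum => a /andP[lea _].
have a2 : (0 < a ^ 2)%N by rewrite expn_gt0 (leq_trans M_gt0).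
by rewrite -natr_sum sum_dvdn // ler_pdivlMr ?ltr0n // -natrM ler_nat leq_trunc_div.
Qed.

Lemma ln_prod (r : seq nat) (P : pred nat) : {in r, forall i, P i -> (0 < i)%N} ->
  ln (\prod_(i <- r | P i) i)%N%:R = \sum_(i <- r | P i) ln i%:R :> R.
Proof.
elim: r => [|a r IH] gt0; first by rewrite !big_nil ln1.
have gt0r : {in r, forall i, P i -> (0 < i)%N}.
  by move=> i ir; apply: gt0; rewrite inE ir orbT.
rewrite !big_cons; case: ifP => Pa; last exact: IH.
rewrite natrM lnM ?posrE ?ltr0n ?IH //; first by rewrite gt0 ?mem_head.
by rewrite big_seq_cond prodn_cond_gt0 // => i /andP[]; apply: gt0r.
Qed.

Lemma sum_ln_primes_le N : \sum_(1 <= p < N.+1 | prime p) ln p%:R <= N%:R * ln 8 :> R.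
Proof.
rewrite -ln_prod => [|i _ /prime_gt0//].
have e : primorial N = (\prod_(1 <= p < N.+1 | prime p) p)%N.
  by rewrite /primorial big_ltn_cond.
rewrite -e mulr_natl -lnXn // -natrX ler_ln ?posrE ?ltr0n ?expn_gt0 //.
  by rewrite ler_nat primorial_le.
by rewrite e prodn_cond_gt0 // => p /prime_gt0.
Qed.

(** Writing [n = p * m], the cofactor [m] still has at most [K] prime divisors; for fixed [m],
    Chebyshev's bound handles the primes [p <= N %/ m]. *)
Lemma sum_ln_prime_factors_le K N :
  \sum_(1 <= n < N.+1) (omega n <= K)%N%:R * (\sum_(p <- primes n) ln p%:R)
    <= N%:R * ln 8 * few_primes_sum K N.
Proof.
pose l p : R := (prime p)%:R * ln p%:R.
have l_ge0 p : 0 <= l p.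
  case: (posnP p) => [->|p_gt0]; first by rewrite /l mul0r.
  by rewrite mulr_ge0 // ln_ge0 // ler1n.
apply: le_trans (_ : \sum_(1 <= n < N.+1) \sum_(1 <= p < N.+1) \sum_(1 <= m < N.+1)
    (p * m == n)%N%:R * ((omega m <= K)%N%:R * l p) <= _).
  rewrite big_nat [leRHS]big_nat; apply: ler_sum => n /andP[n_gt0 len].
  have S_ge0 p : 0 <= \sum_(1 <= m < N.+1) (p * m == n)%N%:R * ((omega m <= K)%N%:R * l p).
    by apply: sumr_ge0 => m _; rewrite mulr_ge0 // mulr_ge0 // l_ge0.
  case: leqP => [leK|_]; last by rewrite mul0r sumr_ge0.
  rewrite mul1r [leRHS](bigID (mem (primes n))) /= ler_wpDr ?sumr_ge0 //.
  rewrite -[leRHS]big_filter.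
  have -> : \sum_(p <- primes n) ln p%:R =
      \sum_(p <- [seq p <- index_iota 1 N.+1 | p \in primes n]) ln p%:R :> R.
    apply: perm_big; apply: uniq_perm; rewrite ?primes_uniq ?filter_uniq ?iota_uniq //.
    move=> p; rewrite mem_filter mem_index_iota; apply/esym/andb_idr.
    rewrite mem_primes n_gt0 => /and3P[/prime_gt0 -> _ /= /dvdn_leq].
    by move=> /(_ n_gt0) le; apply: leq_ltn_trans le len.
  rewrite big_seq [leRHS]big_seq; apply: ler_sum => p.
  rewrite mem_filter mem_primes => /andP[/and3P[pr _ dv] _].
  have q_gt0 : (0 < n %/ p)%N by rewrite divn_gt0 ?prime_gt0 // dvdn_leq.
  rewrite (bigD1_seq (n %/ p)%N) ?iota_uniq ?mem_index_iota ?q_gt0 //=; last first.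
    by rewrite (leq_ltn_trans _ len) // leq_div.
  have <- : l p = ln p%:R by rewrite /l pr mul1r.
  rewrite mulnC divnK // eqxx mul1r.
  have -> : (omega (n %/ p) <= K)%N.
    by rewrite (leq_trans _ leK) // omega_dvdn // dvdn_div.
  by rewrite mul1r ler_wpDr // sumr_ge0 // => m _; rewrite mulr_ge0 // mulr_ge0 // l_ge0.
under eq_bigr do rewrite exchange_big /=.
rewrite exchange_big /= mulr_sumr big_nat [leRHS]big_nat.
apply: ler_sum => m /andP[m_gt0 _].
rewrite exchange_big /=.
have e : \sum_(1 <= p < (N %/ m).+1 | prime p) ln p%:R <= N%:R / m%:R * ln 8 :> R.
  apply: le_trans (sum_ln_primes_le _) _; rewrite ler_wpM2r ?ln_ge0 ?ler1n //.
  by rewrite ler_pdivlMr ?ltr0n // -natrM ler_nat leq_trunc_div.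
have -> : N%:R * ln 8 * ((omega m <= K)%N%:R / m%:R) =
  (omega m <= K)%N%:R * (N%:R / m%:R * ln 8) :> R by ring.
apply: le_trans (ler_wpM2l _ e) => //.
rewrite [in leRHS]big_mkcond /= mulr_sumr.
have leN : ((N %/ m).+1 <= N.+1)%N by rewrite ltnS leq_div.
rewrite [leLHS](big_cat_nat _ leN) //= [X in _ + X]big_nat [X in _ + X]big1 ?addr0.
  apply: ler_sum => p _; rewrite -mulr_suml sum_delta.
  apply: le_trans (_ : 1 * ((omega m <= K)%N%:R * l p) <= _).
    by rewrite ler_wpM2r ?(mulr_ge0 _ (l_ge0 _)) // lern1; case: (_ && _).
  by rewrite mul1r /l; case: prime; rewrite ?mul1r ?mul0r.
move=> p /andP[ltp _]; rewrite -mulr_suml sum_delta.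
have -> : (p * m <= N)%N = false by rewrite leqNgt -ltn_divLR // ltp.
by rewrite andbF mul0r.
Qed.

Lemma ln2_le1 : ln 2 <= 1 :> R.
Proof. by have := @le_ln1Dx R 1; rewrite -[1 + 1]/2; apply; rewrite ltrNl. Qed.

Lemma ln_le_square_decomposition (t N n : nat) : (0 < n)%N -> (n <= N)%N ->
  ~~ square_divisor_ge (2 ^ t) N n ->
  ln n%:R <= 2 * t%:R + \sum_(p <- primes n) ln p%:R :> R.
Proof.
move=> n_gt0 leN nsq.
have n_in : (0 < n <= N)%N by rewrite n_gt0.
have [a [s [ns /andP[a_gt0 at2] s_gt0 sqs]]] := small_square_decomposition _ _ _ n_in nsq.
rewrite {1}ns natrM natrX lnM ?posrE ?exprn_gt0 ?ltr0n // lnXn ?ltr0n //.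
apply: lerD.
  rewrite -[ln _ *+ 2]mulr_natl ler_wpM2l //; apply: le_trans (_ : ln (2 ^ t)%:R <= _).
    by rewrite ler_ln ?posrE ?ltr0n ?expn_gt0 // ler_nat.
  by rewrite natrX lnXn // -[ln 2 *+ t]mulr_natr ler_piMl // ln2_le1.
rewrite -[X in ln X%:R](prod_primes_sqf _ s_gt0 sqs) ln_prod; last first.
  by move=> p; rewrite mem_primes => /and3P[/prime_gt0].
have sub : {subset primes s <= primes n}.
  move=> p; rewrite !mem_primes n_gt0 => /and3P[-> _ dv]; rewrite ns.
  exact: dvdn_mull.
rewrite [leRHS](bigID (mem (primes s))) /= ler_wpDr //.
  rewrite sumr_ge0 // => p _; case: (posnP p) => [->|p_gt0]; first by rewrite ln0.
  by rewrite ln_ge0 // ler1n.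
rewrite -[leRHS]big_filter le_eqVlt; apply/orP; left; apply/eqP.
apply: perm_big; apply: uniq_perm; rewrite ?filter_uniq ?primes_uniq // => p.
by rewrite mem_filter; apply/esym/andb_idr => /sub.
Qed.

(* Each n is weighted by ln N = ln (N / n) + ln n; after the square part of n is
   discarded, ln n becomes a sum over primes p | n, and n / p again has few
   prime factors. *)
Lemma sum_few_primes_le (t K N : nat) : (0 < N)%N -> (4 <= t)%N -> (2 ^ t)%:R <= ln N%:R :> R ->
  \sum_(1 <= n < N.+1) (~~ square_divisor_ge (2 ^ t) N n && (omega n <= K)%N)%:R
    <= 8 * N%:R / ln N%:R * few_primes_sum K N.
Proof.
move=> N_gt0 t_ge4 let2.
have lnN_gt0 : 0 < ln N%:R :> R by apply: lt_le_trans let2; rewrite ltr0n expn_gt0.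
set S := \sum_(1 <= n < N.+1) _; set T := few_primes_sum K N.
have T_ge0 : 0 <= T by apply: sumr_ge0 => m _; rewrite divr_ge0.
have S_ge0 : 0 <= S by apply: sumr_ge0.
(* The three terms come from ln(N/n) <= N/n, from the square part of [n], and from the primes
   dividing [n]. *)
have key : S * ln N%:R <= N%:R * T + (S * (2 * t%:R) + N%:R * ln 8 * T).
  apply: le_trans (lerD (lexx _) (lerD (lexx _) (sum_ln_prime_factors_le K N))).
  rewrite /S /T /few_primes_sum !mulr_suml mulr_sumr -!big_split /=.
  rewrite big_nat [leRHS]big_nat; apply: ler_sum => n /andP[n_gt0 len].
  have pr_ge0 : 0 <= \sum_(p <- primes n) ln p%:R :> R.
    apply: sumr_ge0 => p _; case: (posnP p) => [->|p_gt0]; first by rewrite ln0.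
    by rewrite ln_ge0 // ler1n.
  case: (boolP (square_divisor_ge _ _ _)) => [_|nsq] /=.
    by rewrite !mul0r add0r addr_ge0 ?mulr_ge0 // invr_ge0.
  case: leqP => _; last by rewrite !mul0r mulr0 !addr0.
  rewrite !mul1r; have n0 : 0 < n%:R :> R by rewrite ltr0n.
  have N0 : 0 < N%:R :> R by rewrite ltr0n.
  have := ln_le_square_decomposition t N n n_gt0 len nsq.
  have := @le_ln1Dx R (N%:R / n%:R - 1).
  rewrite subrKC ln_div ?posrE //.
  have -> : -1 < N%:R / n%:R - 1 :> R by rewrite ltrBrDl subrr divr_gt0.
  move=> /(_ isT).
  by move: (ln n%:R) (ln N%:R) (N%:R / n%:R) (\sum_(_ <- _) _) (t%:R : R) => *; lra.
(* This moves half of [S * ln N] to the left; the rest is at most [N * T * (1 + ln 8)] with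
   [ln 8 <= 3], whence the constant 8. *)
have t2 : 4 * t%:R <= ln N%:R :> R.
  apply: le_trans let2; rewrite -natrM ler_nat.
  elim: t t_ge4 {S S_ge0 key} => // t IH; rewrite leq_eqVlt => /orP[/eqP<-//|gt].
  by have := IH gt; rewrite expnS; lia.
have ln8 : ln 8 <= 3 :> R.
  have -> : 8 = 2 ^+ 3 :> R by rewrite -natrX.
  rewrite lnXn // -[ln 2 *+ 3]mulr_natr; have := ln2_le1; lra.
have N0 : 0 <= N%:R :> R by [].
have : N%:R * ln 8 * T <= N%:R * 3 * T by rewrite ler_wpM2r // ler_wpM2l.
have : S * (4 * t%:R) <= S * ln N%:R by rewrite ler_wpM2l.
move=> h1 h2; have h3 : S * ln N%:R <= 8 * (N%:R * T) by lra.
have -> : 8 * N%:R / ln N%:R * T = 8 * (N%:R * T) / ln N%:R by ring.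
by rewrite ler_pdivlMr.
Qed.

End Sums.

(** * Counting *)

Lemma countB_sum (R : realType) (x : R) : 0 <= x ->
  countB x = (\sum_(1 <= n < (Num.truncn x).+1) (f n %| n))%N.
Proof.
move=> x_ge0; rewrite -big_mkcond sum1_count -size_filter /countB.
set s := [seq _ <- _ | _].
have -> : fset_set (Bupto x) = [fset n in s]%fset.
  apply/fsetP => n; rewrite in_fset_set ?inE; last exact: finite_Bupto.
  rewrite mem_filter mem_index_iota ltnS truncn_ge_nat // andbCA.
  by apply/idP/idP => [/set_mem[[-> ->]]|/and3P[n_gt0 dv le]] //; apply/mem_set.
by rewrite card_fseq undup_id // filter_uniq // iota_uniq.
Qed.

(** All counted [n] with the same code share one value [f n0 >= V] and are multiples of it, so each
    code accounts for at most [N %/ V] of them. *)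
Lemma sum_large_f_le s M V N : (M < s.+1 ^ 2)%N -> (0 < V)%N ->
  (\sum_(1 <= n < N.+1) ((f n %| n) && (bigomega n <= M) && (V <= f n))
    <= (M.+1) ^ (2 * s + 1) * (N %/ V))%N.
Proof.
move=> ltM V_gt0; pose C : finType := ({ffun 'I_s.+1 -> 'I_M.+1} * {ffun 'I_s -> 'I_M.+1})%type.
pose P n := (f n %| n)%N && (bigomega n <= M)%N && (V <= f n)%N.
have -> : ((M.+1) ^ (2 * s + 1) = #|C|)%N.
  by rewrite card_prod !card_ffun !card_ord -expnD; congr (_ ^ _)%N; lia.
apply: (@leq_trans (\sum_(1 <= n < N.+1) \sum_(c : C) (P n && (exponent_code s M n == c)))%N).
  apply: leq_sum => n _; rewrite (bigD1 (exponent_code s M n)) //= eqxx andbT.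
  exact: leq_addr.
rewrite exchange_big /= -sum_nat_const; apply: leq_sum => c _.
case: (boolP (has (fun n => P n && (exponent_code s M n == c)) (index_iota 1 N.+1))); last first.
  move/hasPn => no; rewrite big_seq big1 // => n /no /negPf -> //.
case/hasP => n0; rewrite mem_index_iota => /andP[n0_gt0 _].
case/andP => /andP[/andP[_ om0] leV] /eqP code0.
apply: (@leq_trans (N %/ f n0)%N); last by rewrite leq_div2l.
rewrite -sum_dvdn ?(leq_trans V_gt0) // big_nat [leqRHS]big_nat.
apply: leq_sum => n /andP[n_gt0 _].
case: (boolP (P n)) => //= /andP[/andP[dv om] _]; case: eqP => //= code.
by rewrite -(f_exponent_code _ _ _ _ ltM n_gt0 n0_gt0 om om0) ?dv // code.
Qed.

Lemma bigomega_le_omega t N n : (0 < n <= N)%N -> ~~ square_divisor_ge (2 ^ t) N n ->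
  (bigomega n <= omega n + 2 * t)%N.
Proof.
move=> n_in nsq; have /andP[n_gt0 _] := n_in.
have [a [s [ns /andP[a_gt0 at2] s_gt0 sqs]]] := small_square_decomposition _ _ _ n_in nsq.
have at1 : (bigomega a <= t)%N.
  by rewrite -(@leq_exp2l 2) // (leq_trans (exp2_bigomega _ a_gt0)).
rewrite {1}ns bigomegaM ?expn_gt0 ?a_gt0 // -mulnn bigomegaM // (bigomega_sqf s) //.
have : (omega s <= omega n)%N by rewrite omega_dvdn // ns dvdn_mull.
lia.
Qed.

(** This is [exp_le_f] with [m = 2 ^ b]: the exponent [b * (omega n - 2 ^ b)] of 2 must stay below
    [t]. *)
Lemma omega_le_of_f_lt b t n : (0 < b)%N -> (0 < n)%N -> (f n < 2 ^ t)%N ->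
  (omega n <= 2 ^ b + t %/ b)%N.
Proof.
move=> b_gt0 n_gt0 ltf; case: (leqP (2 ^ b) (omega n)) => [le|lt]; last first.
  by rewrite (leq_trans (ltnW lt)) // leq_addr.
have b2 : (0 < 2 ^ b)%N by rewrite expn_gt0.
have := @exp_le_f (2 ^ b) n n_gt0; rewrite b2 le => /(_ isT) lef.
have := leq_ltn_trans lef ltf; rewrite -expnM ltn_exp2l // => lt.
by rewrite -leq_subLR leq_divRL // mulnC ltnW.
Qed.

Lemma exp2_double t : (2 ^ (2 * t + 2) = (2 * 2 ^ t) * (2 * 2 ^ t))%N.
Proof. by rewrite -expnS -expnD addnn -mul2n mulnS [in RHS]addnC. Qed.

Section Bounds.
Context {R : realType}.

Lemma count_upper_bound (b c s t N : nat) : (0 < b)%N -> (4 <= t)%N -> (0 < N)%N ->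
  (4 * t + 1 < s.+1 ^ 2)%N -> (2 ^ t)%:R <= ln N%:R :> R -> ln N%:R < (2 ^ t.+1)%:R :> R ->
  (\sum_(1 <= n < N.+1) (f n %| n))%N%:R <=
    N%:R / ln N%:R * (6 + 2 * (4 * t + 2) ^ (2 * s + 1)
      + 16 * 2 ^ (c * (2 ^ b + t %/ b) + ((c + t + 2) %/ 2 ^ c).+1))%N%:R :> R.
Proof.
move=> b_gt0 t_ge4 N_gt0 lts let2 ltt2.
pose K := (2 ^ b + t %/ b)%N; pose l : R := ln N%:R.
have t2_gt0 : (0 : R) < (2 ^ t)%:R by rewrite ltr0n expn_gt0.
have l_gt0 : 0 < l by apply: lt_le_trans let2.
have l_ge1 : 1 <= l by apply: le_trans let2; rewrite ler1n expn_gt0.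
have l2 : l < 2 * (2 ^ t)%:R by rewrite -natrM -expnS.
have inv2 : ((2 ^ t)%:R)^-1 <= 2 / l.
  by rewrite -(@invrK _ 2) -invfM lef_pV2 ?posrE // ?mulr_gt0 ?invr_gt0 //; lra.
have NR : (0 : R) <= N%:R by [].
(* Every counted [n] has a large square divisor ([A1]), many primes ([A2]), a large value of [f]
   ([A3]), or a small value of [f] and hence few primes ([A4]). *)
pose A1 n := square_divisor_ge (2 ^ t) N n.
pose A2 n := (2 * t + 2 <= omega n)%N.
pose A3 n := (f n %| n)%N && (bigomega n <= 4 * t + 1)%N && (2 ^ t <= f n)%N.
pose A4 n := ~~ square_divisor_ge (2 ^ t) N n && (omega n <= K)%N.
apply: (@le_trans _ _ (\sum_(1 <= n < N.+1) (A1 n)%:R + \sum_(1 <= n < N.+1) (A2 n)%:R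
   + \sum_(1 <= n < N.+1) (A3 n)%:R + \sum_(1 <= n < N.+1) (A4 n)%:R)).
  rewrite -!natr_sum -!natrD ler_nat -!big_split /=.
  rewrite big_nat [leqRHS]big_nat; apply: leq_sum => n /andP[n_gt0 len].
  have len' : (0 < n <= N)%N by rewrite n_gt0.
  rewrite /A1 /A2 /A3 /A4; case: (boolP (f n %| n)%N) => // dv.
  case: (boolP (square_divisor_ge _ _ _)) => [_|nsq] //=.
  case: (leqP (2 * t + 2) (omega n)) => //= lto.
  have -> : (bigomega n <= 4 * t + 1)%N.
    by have := bigomega_le_omega _ _ _ len' nsq; move: lto; clear; lia.
  case: (leqP (2 ^ t) (f n)) => //= ltf.
  by rewrite (omega_le_of_f_lt _ _ _ b_gt0 n_gt0 ltf).
have E1 : \sum_(1 <= n < N.+1) (A1 n)%:R <= N%:R / l * 4 :> R.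
  apply: le_trans (sum_square_divisor_ge _ _ _) _; first by rewrite expn_gt0.
  by rewrite -mulrA ler_wpM2l //; lra.
(* Markov's inequality for [2 ^ omega n]: its sum is at most [N * (1 + l)], and the threshold
   [2 ^ (2 * t + 2)] is at least [l * l]. *)
have E2 : \sum_(1 <= n < N.+1) (A2 n)%:R <= N%:R / l * 2 :> R.
  have [q qE] : exists q : R, q = (2 ^ (2 * t + 2))%:R by eexists.
  have q_gt0 : 0 < q by rewrite qE ltr0n expn_gt0.
  have lq : l * l <= q.
    have e2 := exp2_double t.
    rewrite qE e2 (natrM _ (2 * 2 ^ t)) (natrM _ 2).
    by rewrite ler_pM // ltW.
  apply: (@le_trans _ _ ((\sum_(1 <= n < N.+1) (2 ^ omega n)%:R) / q)).
    rewrite mulr_suml; apply: ler_sum => n _; rewrite /A2; case: leqP => [le|_] /=.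
      by rewrite ler_pdivlMr // mul1r qE ler_nat leq_exp2l.
    by rewrite divr_ge0 // ltW.
  rewrite ler_pdivrMr //; apply: le_trans (sum_exp2_omega_le N N_gt0) _.
  rewrite -/l; have -> : N%:R / l * 2 * q = N%:R * (2 * q / l) by ring.
  rewrite ler_wpM2l // ler_pdivlMr //.
  have : 1 * l <= l * l by rewrite ler_wpM2r // ltW.
  by lra.
have E3 : \sum_(1 <= n < N.+1) (A3 n)%:R <= N%:R / l * (2 * (4 * t + 2) ^ (2 * s + 1))%N%:R :> R.
  rewrite -natr_sum; have t2 : (0 < 2 ^ t)%N by rewrite expn_gt0.
  have := sum_large_f_le s (4 * t + 1) (2 ^ t) N lts t2; rewrite -(ler_nat R) => /le_trans; apply.
  have -> : (4 * t + 1).+1 = (4 * t + 2)%N by rewrite addn1 addn2.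
  rewrite natrM [X in _ <= X]mulrC natrM; set P : R := ((4 * t + 2) ^ (2 * s + 1))%:R.
  have -> : 2 * P * (N%:R / l) = P * (N%:R * (2 / l)) by ring.
  rewrite ler_wpM2l //; apply: (@le_trans _ _ (N%:R / (2 ^ t)%:R)); last by rewrite ler_wpM2l.
  by rewrite ler_pdivlMr // -natrM ler_nat leq_trunc_div.
have E4 : \sum_(1 <= n < N.+1) (A4 n)%:R <=
    N%:R / l * (16 * 2 ^ (c * K + ((c + t + 2) %/ 2 ^ c).+1))%N%:R.
  apply: le_trans (sum_few_primes_le _ _ _ N_gt0 t_ge4 let2) _.
  rewrite -/l; set D := weighted_sum (2 ^- c) N : R.
  set e := ((c + t + 2) %/ 2 ^ c).+1.
  have D_ge0 : 0 <= D by rewrite weighted_sum_ge0 // invr_ge0 exprn_ge0.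
  (* The successor in [e] rounds the root up: [D > 2 ^ e] would make the power [2 ^ c] of [D] exceed
     [2 ^ (c + t + 2)], which is already at least [1 + 2 ^ c * l]. *)
  have De : D <= (2 ^ e)%:R.
    have c2 : (0 < 2 ^ c)%N by rewrite expn_gt0.
    rewrite leNgt; apply/negP => lt.
    have : (2 ^ e)%:R ^+ (2 ^ c) < D ^+ (2 ^ c) by rewrite ltrXn2r // ?nnegrE // -lt0n.
    have := @weighted_sum_le R c N N_gt0; rewrite -/D -/l => le1 lt1.
    have {le1 lt1} := lt_le_trans lt1 le1; apply/negP; rewrite -leNgt.
    apply: (@le_trans _ _ (2 ^ (c + t + 2))%:R); last first.
      by rewrite -natrX ler_nat -expnM leq_exp2l // ltnW // ltn_ceil.
    have e2 : (2 ^ (c + t + 2) = 2 ^ c * (2 * 2 ^ t) * 2)%N.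
      by clear; rewrite !expnD; lia.
    rewrite e2 natrM (natrM _ (2 ^ c)) (natrM _ 2).
    have c1 : (1 : R) <= (2 ^ c)%:R by rewrite ler1n.
    have : (2 ^ c)%:R * l <= (2 ^ c)%:R * (2 * (2 ^ t)%:R) by rewrite ler_wpM2l // ltW.
    have : 1 * 1 <= (2 ^ c)%:R * l by rewrite ler_pM.
    by lra.
  apply: (@le_trans _ _ (8 * N%:R / l * ((2 ^ (c * K))%:R * 2 * (2 ^ e)%:R))).
    rewrite ler_wpM2l ?divr_ge0 ?mulr_ge0 ?(ltW l_gt0) //.
    apply: le_trans (few_primes_sum_le c K N) _.
    by rewrite ler_wpM2l // mulr_ge0.
  rewrite expnD natrM (natrM _ (2 ^ _)) le_eqVlt; apply/orP; left; apply/eqP.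
  by move: (2 ^ (c * K))%:R (2 ^ e)%:R => u v; ring.
have e6 (A B : nat) : (6 + A + B)%N%:R = 4 + 2 + A%:R + B%:R :> R.
  by rewrite natrD (natrD _ 6); lra.
by rewrite e6 (mulrDr _ (4 + 2 + _)) (mulrDr _ (4 + 2)) (mulrDr _ 4); apply: lerD E4; apply: lerD E3; apply: lerD E1 E2.
Qed.

Lemma primes_lower_bound (N : nat) : (2 <= N)%N ->
  N%:R / (8 * ln N%:R) <= (\sum_(1 <= n < N.+1) (f n %| n))%N%:R :> R.
Proof.
move=> N_ge2; pose n := N./2.
have n_gt0 : (0 < n)%N by rewrite half_gt0.
have leN : (n.*2 <= N)%N by rewrite /n -[leqRHS]odd_double_half leq_addl.
have lnN : 0 < ln N%:R :> R by rewrite ln_gt0 // ltr1n.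
apply: (@le_trans _ _ (primepi N)%:R); last first.
  rewrite ler_nat /primepi big_ltn_cond //= big_mkcond /=; apply: leq_sum => p _.
  by case: (boolP (prime p)) => // pr; rewrite f_prime // dvd1n.
have pile : (primepi n.*2 <= primepi N)%N.
  by rewrite /primepi [leqRHS](@big_cat_nat _ _ _ n.*2.+1) //= leq_addr.
have le1 := leq_trans (central_bin_ge n) (central_bin_le n n_gt0).
have : (2 ^ n <= N ^ primepi N)%N.
  apply: leq_trans le1 _; apply: leq_trans (_ : N ^ primepi n.*2 <= _)%N.
    by case: (primepi _) => // e; rewrite leq_exp2r.
  by rewrite leq_pexp2l // ltnW.
rewrite -(ler_nat R) => le2.
have : ln (2 ^ n)%:R <= ln (N ^ primepi N)%:R :> R.
  by rewrite ler_ln ?posrE ?ltr0n ?expn_gt0 // ltnW.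
rewrite !natrX !lnXn ?ltr0n 1?ltnW // -[ln 2 *+ n]mulr_natr -[ln _ *+ _]mulr_natr => le3.
have ln2 : 2^-1 <= ln 2 :> R.
  have := @le_ln1Dx R (- 2^-1); have -> : 1 + - 2^-1 = 2^-1 :> R by lra.
  rewrite lnV ?posrE // lerN2; apply; lra.
(* Rounding in [N./2] costs at most this factor 4; with [ln 2 >= 1 / 2] it gives the constant 8. *)
have nN : N%:R <= 4 * n%:R :> R.
  rewrite -natrM ler_nat /n; have := odd_double_half N; lia.
rewrite ler_pdivrMr ?mulr_gt0 //.
have : n%:R * 2^-1 <= n%:R * ln 2 :> R by rewrite ler_wpM2l.
lra.
Qed.

End Bounds.

(** * From dyadic parameters to real exponents *)

Lemma exists_dyadic (R : realType) (y : R) : 1 <= y ->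
  exists t, (2 ^ t)%:R <= y /\ y < (2 ^ t.+1)%:R.
Proof.
move=> y_ge1; have y_ge0 : 0 <= y by lra.
have /andP[ley lty] := truncn_itv y_ge0.
exists (trunc_log 2 (Num.truncn y)); split.
  by apply: le_trans ley; rewrite ler_nat trunc_logP // truncn_gt0.
by apply: lt_le_trans lty _; rewrite ler_nat trunc_log_ltn.
Qed.

Lemma exp2_divn_le_powR (R : realType) (y : R) (t q : nat) : (0 < q)%N ->
  (2 ^ t)%:R <= y -> (2 ^ (t %/ q))%:R <= y `^ q%:R^-1.
Proof.
move=> q_gt0 ley; have q0 : (q%:R : R) != 0 by rewrite pnatr_eq0 -lt0n.
have y_ge0 : 0 <= y by apply: le_trans ley.
have e (z : R) : 0 <= z -> z = (z ^+ q) `^ q%:R^-1.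
  by move=> z_ge0; rewrite -powR_mulrn // -powRrM divff // powRr1.
rewrite [leLHS]e //.
apply: ge0_ler_powR; rewrite ?nnegrE ?invr_ge0 ?exprn_ge0 //.
by apply: le_trans ley; rewrite -natrX ler_nat -expnM leq_exp2l // leq_trunc_div.
Qed.

Theorem theorem3 (R : realType) (eps : R) (eps_gt0 : 0 < eps) :
  exists x0 : R, forall x : R, x0 <= x ->
    x / ((ln x) `^ (1 + eps)) <= (countB x)%:R /\
    (countB x)%:R <= x / ((ln x) `^ (1 - eps)).
Proof.
(* Half of [eps] pays for [2 ^ (t %/ q)]; the other half, as [p = l ^ (eps / 2) >= 16], absorbs the
   constants. *)
pose q := (Num.truncn (2 / eps)).+1.
have q_le : q%:R^-1 <= eps / 2.
  have q_gt : 2 / eps < q%:R.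
    by have /truncn_itv/andP[] : 0 <= 2 / eps by rewrite divr_ge0 // ltW.
  by rewrite -[eps / 2]invf_div lef_pV2 ?posrE ?divr_gt0 ?ltr0n // ltW.
have [b [c [t0 [b_gt0 bound]]]] := subpolynomial_bound q isT.
(* The first summand of [W] yields [16 <= p]; the second forces [t1 <= t], as needed for [bound] and
   [count_upper_bound]. *)
pose t1 := maxn t0 4; pose W : R := 16 `^ (2 / eps) + (2 ^ t1)%:R.
have W1 : (2 ^ t1)%:R <= W by rewrite lerDr powR_ge0.
have W2 : 16 `^ (2 / eps) <= W by rewrite lerDl.
have t1_ge1 : (1 : R) <= (2 ^ t1)%:R by rewrite ler1n expn_gt0.
(* The added 1 compensates for truncation, so that [expR W <= N]. *)
exists (expR W + 1) => x lex; set N := Num.truncn x.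
have expW : 1 + W <= expR W by apply: expR_ge1Dx.
have x_ge0 : 0 <= x by lra.
have /andP[leNx ltxN] := truncn_itv x_ge0; rewrite -/N -natr1 in leNx ltxN.
have leWN : expR W <= N%:R by lra.
have N_gt0R : 0 < N%:R :> R by lra.
have N_gt0 : (0 < N)%N by rewrite -(ltr0n R).
have N_ge2 : (2 <= N)%N by rewrite -(ler_nat R); lra.
have x_gt0 : 0 < x by lra.
set l := ln x; set k : R := ln N%:R.
have leWk : W <= k by rewrite -[W]expRK /k ler_ln ?posrE ?expR_gt0.
have lekl : k <= l by rewrite /k /l ler_ln ?posrE.
have k_gt0 : 0 < k by lra.
have l_gt0 : 0 < l by lra.
(* Since x < N + 1 <= N^2, replacing [ln N] by [ln x] costs at most a factor 2. *)
have lel2k : l <= 2 * k.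
  have -> : 2 * k = ln (N%:R ^+ 2) by rewrite lnXn // -[RHS]mulr_natl.
  rewrite /l ler_ln ?posrE ?exprn_gt0 //; apply: le_trans (ltW ltxN) _.
  have : (2 : R) <= N%:R by rewrite ler_nat.
  by rewrite expr2; nra.
pose p := l `^ (eps / 2).
have p_ge : 16 <= p.
  have e2 : (eps / 2 : R) = (2 / eps)^-1 by rewrite invf_div.
  have ne : 2 / eps != 0 by rewrite mulf_neq0 // invr_eq0 gt_eqF.
  have e16 : 16 = (16 `^ (2 / eps)) `^ (eps / 2) :> R.
    by rewrite e2 -powRrM divff // powRr1.
  rewrite /p [leLHS]e16.
  by apply: ge0_ler_powR; rewrite ?nnegrE ?powR_ge0 //; lra.
have lp : l `^ eps = p ^+ 2.
  by rewrite -powR_mulrn ?powR_ge0 // -powRrM; congr (_ `^ _); lra.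
have l_neq0 : l != 0 by rewrite gt_eqF.
have -> : l `^ (1 + eps) = l * p ^+ 2.
  by rewrite powRD ?l_neq0 ?implybT // powRr1 ?ltW // lp.
have -> : l `^ (1 - eps) = l / p ^+ 2.
  by rewrite powRB ?l_neq0 ?implybT // powRr1 ?ltW // lp.
have p_gt0 : 0 < p by lra.
rewrite countB_sum // -/N; split.
  apply: le_trans (primes_lower_bound N N_ge2); rewrite -/k.
  have N_ge1 : (1 : R) <= N%:R by rewrite ler1n.
  have h : x <= 2 * N%:R by lra.
  rewrite ler_pdivrMr ?mulr_gt0 ?exprn_gt0 //.
  apply: le_trans h _; rewrite mulrAC ler_pdivlMr ?mulr_gt0 //.
  (* 16 is the 8 of [primes_lower_bound] times the 2 from [x <= 2 * N]. *)
  have : 16 * k <= p ^+ 2 * l.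
    apply: ler_pM => //; first exact: ltW.
    by apply: (le_trans p_ge); rewrite expr2; apply: ler_peMl; lra.
  move=> h2; have : N%:R * (16 * k) <= N%:R * (p ^+ 2 * l) by rewrite ler_wpM2l.
  lra.
have k_ge1 : 1 <= k by lra.
have [t [let2 ltt2]] := exists_dyadic R k k_ge1.
have let1 : (t1 <= t)%N.
  rewrite -ltnS -(@ltn_exp2l 2) // -(ltr_nat R); apply: le_lt_trans ltt2; lra.
have t_ge4 : (4 <= t)%N by apply: leq_trans let1; apply: leq_maxr.
have let0 : (t0 <= t)%N by apply: leq_trans let1; apply: leq_maxl.
have [s lts G] := bound t let0.
apply: le_trans (count_upper_bound b c s t N b_gt0 t_ge4 N_gt0 lts let2 ltt2) _.
rewrite -/k; apply: (@le_trans _ _ (N%:R / k * p)).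
  rewrite ler_wpM2l ?divr_ge0 ?(ltW k_gt0) //.
  apply: (@le_trans _ _ (2 ^ (t %/ q))%:R); first by rewrite ler_nat.
  apply: le_trans (exp2_divn_le_powR R k t q isT let2) _.
  apply: (@le_trans _ _ (k `^ (eps / 2))); first exact: ler_powR.
  by apply: ge0_ler_powR; rewrite ?nnegrE ?divr_ge0 ?(ltW eps_gt0) ?(ltW k_gt0) ?(ltW l_gt0).
(* The remaining factor [l / k <= 2] is absorbed by the second factor [p]. *)
rewrite invf_div mulrA ler_pdivlMr //.
have -> : N%:R / k * p * l = (N%:R * p) * (l / k) by ring.
apply: (@le_trans _ _ (N%:R * p * 2)).
  rewrite ler_wpM2l ?mulr_ge0 ?(ltW p_gt0) //.
  by rewrite ler_pdivrMr.
have : N%:R * (p * 2) <= x * (p * p).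
  apply: ler_pM => //; first by rewrite mulr_ge0 // ltW.
  by rewrite ler_wpM2l ?(ltW p_gt0) //; lra.
by rewrite expr2; lra.
Qed.
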